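(* Let $F_0:M^n\to\mathbb R^{2n}$ be a proper Lagrangian immersion and let $F:M\times[0,T]\to\mathbb R^{2n}$ be a mean curvature flow with $F(\cdot,0)=F_0$ and with uniformly bounded second fundamental form. Then $F_t=F(\cdot,t)$ is Lagrangian for all $t\in[0,T]$.
   Context: Mean curvature flow: a (smooth) family of immersions $F(\cdot,t):M\to\mathbb R^{2n}$, $t\in[0,T]$, of an $n$-dimensional manifold $M$, satisfying $\frac{\partial F}{\partial t}(x,t)=\vec H(x,t)$, where $\vec H=\operatorname{tr}A$ is the mean curvature vector of $F(\cdot,t)$ (trace with respect to the induced metric) and $A(X,Y)=(\overline\nabla_XY)^\perp$ is its second fundamental form ($\overline\nabla$ the flat connection of $\mathbb R^{2n}$, $\perp$ the projection to the normal space). Uniformly bounded second fundamental form means that there is $C_0>0$ with $\|A(x,t)\|\le C_0$ for all $(x,t)\in M\times[0,T]$. Proper means preimages of compact sets are compact. An immersion of an $n$-manifold into $\mathbb R^{2n}$ is Lagrangian if the standard symplectic form of $\mathbb R^{2n}$ pulls back to zero, equivalently if every tangent plane is a Lagrangian subspace. *)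

(* Defs.v *)
From mathcomp Require Import all_boot all_order all_algebra.
From mathcomp Require Import all_classical all_reals all_analysis.
Set Implicit Arguments.
Unset Strict Implicit.
Unset Printing Implicit Defensive.
Import Order.TTheory GRing.Theory Num.Theory.
Import numFieldNormedType.Exports.
Local Open Scope classical_set_scope.
Local Open Scope ring_scope.

(* C^oo on an open set [U], for finite-dimensional [V] and [W]: every iterated
   directional derivative is differentiable (hence continuous) on [U]. *)
Definition smooth_on (R : realType) (V W : normedModType R)
    (U : set V) (f : V -> W) : Prop :=
  forall (vs : seq V) (x : V), U x ->
    differentiable (foldr (fun v (g : V -> W) => fun y => 'D_v g y) f vs) x.

Record chart (R : realType) (n : nat) (M : topologicalType) := Chart {
  chart_dom : set M ;
  chart_map :> M -> 'rV[R]_n ;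
  (* only meaningful on the image of [chart_dom] *)
  chart_inv : 'rV[R]_n -> M ;
  chart_dom_open : open chart_dom ;
  chart_img_open : open (chart_map @` chart_dom) ;
  chart_mapK : {in chart_dom, cancel chart_map chart_inv} ;
  chart_map_continuous : {within chart_dom, continuous chart_map} ;
  chart_inv_continuous :
    {within chart_map @` chart_dom, continuous chart_inv} }.

Definition chart_img (R : realType) (n : nat) (M : topologicalType)
    (c : chart R n M) : set 'rV[R]_n := c @` chart_dom c.

Record smooth_manifold (R : realType) (n : nat) := SmoothManifold {
  carrier :> topologicalType ;
  manifold_hausdorff : hausdorff_space carrier ;
  manifold_second_countable : @second_countable carrier ;
  atlas : set (chart R n carrier) ;
  atlas_cover : forall x : carrier, exists2 c, atlas c & chart_dom c x ;
  atlas_compatible : forall c d, atlas c -> atlas d ->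
    smooth_on (c @` (chart_dom c `&` chart_dom d)) (d \o chart_inv c) }.

Section Ambient.
Variables (R : realType) (n : nat).

Definition dotv (m : nat) (u v : 'rV[R]_m) : R := (u *m v^T) 0 0.

(* sum_i dx_i /\ dy_i, with R^2n seen as R^n x R^n, coordinates (x, y) *)
Definition symplectic_form (u v : 'rV[R]_(n + n)) : R :=
  dotv (lsubmx u) (rsubmx v) - dotv (rsubmx u) (lsubmx v).

End Ambient.

(* Geometry of an immersion [f] of an open subset of R^n (the expression of an
   immersion in a chart) at a point [p]; tangent vectors of the source are
   row vectors, and the rows of [jacobian f p] are the d_i f (p). *)
Section LocalGeometry.
Variables (R : realType) (n m : nat) (f : 'rV[R]_n -> 'rV[R]_m).

Definition induced_metric (p : 'rV[R]_n) : 'M[R]_n :=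
  jacobian f p *m (jacobian f p)^T.

(* orthogonal projection onto the normal space, the orthogonal complement of
   the row space of the Jacobian *)
Definition normal_part (p : 'rV[R]_n) (w : 'rV[R]_m) : 'rV[R]_m :=
  w *m proj_mx (kermx (jacobian f p)^T) <<jacobian f p>>%MS.

(* derivative, in the direction [X], of the vector field df(Y) along [f] *)
Definition flat_connection (X Y : 'rV[R]_n -> 'rV[R]_n) (p : 'rV[R]_n) :
    'rV[R]_m :=
  'D_(X p) (fun q => 'd f q (Y q)) p.

Definition second_fundamental_form (X Y : 'rV[R]_n -> 'rV[R]_n)
    (p : 'rV[R]_n) : 'rV[R]_m :=
  normal_part p (flat_connection X Y p).

Definition coord_field (i : 'I_n) : 'rV[R]_n -> 'rV[R]_n :=
  cst (delta_mx 0 i).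

Definition sff_coef (p : 'rV[R]_n) (i j : 'I_n) : 'rV[R]_m :=
  second_fundamental_form (coord_field i) (coord_field j) p.

Definition mean_curvature (p : 'rV[R]_n) : 'rV[R]_m :=
  \sum_i \sum_j invmx (induced_metric p) i j *: sff_coef p i j.

(* ||A||^2 = g^ik g^jl <A_ij, A_kl> *)
Definition sff_norm (p : 'rV[R]_n) : R :=
  let ginv := invmx (induced_metric p) in
  Num.sqrt (\sum_i \sum_j \sum_k \sum_l
    ginv i k * ginv j l * dotv (sff_coef p i j) (sff_coef p k l)).

End LocalGeometry.

(* Tensorial conditions at a point of M are required in every chart of the
   atlas around the point; they do not depend on the chart. *)
Section Immersions.
Variables (R : realType) (n : nat) (M : smooth_manifold R n).

Definition in_chart (m : nat) (f : M -> 'rV[R]_m) (c : chart R n M) :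
    'rV[R]_n -> 'rV[R]_m :=
  f \o chart_inv c.

Definition immersion (m : nat) (f : M -> 'rV[R]_m) : Prop :=
  forall c : chart R n M, atlas c ->
    smooth_on (chart_img c) (in_chart f c) /\
    (forall x, chart_dom c x -> injective ('d (in_chart f c) (c x))).

Definition lagrangian (f : M -> 'rV[R]_(n + n)) : Prop :=
  forall (c : chart R n M) (x : M), atlas c -> chart_dom c x ->
    forall a b : 'rV[R]_n,
      symplectic_form ('d (in_chart f c) (c x) a)
                      ('d (in_chart f c) (c x) b) = 0.

Definition proper_map (m : nat) (f : M -> 'rV[R]_m) : Prop :=
  forall K : set 'rV[R]_m, compact K -> compact (f @^-1` K).

(* smoothness on the manifold with boundary M x [0, T]: smooth local extension
   across the times 0 and T *)
Definition smooth_family (m : nat) (T : R) (F : M -> R -> 'rV[R]_m) : Prop :=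
  forall c : chart R n M, atlas c ->
  forall (p : 'rV[R]_n) (t : R), chart_img c p -> 0 <= t <= T ->
    exists (W : set ('rV[R]_n * R)%type) (G : ('rV[R]_n * R)%type -> 'rV[R]_m),
      [/\ open W, W (p, t), smooth_on W G &
          forall q s, W (q, s) -> chart_img c q -> 0 <= s <= T ->
            G (q, s) = F (chart_inv c q) s].

(* dF/dt = H on [0, T], with a one-sided derivative at the times 0 and T *)
Definition mean_curvature_flow (m : nat) (T : R) (F : M -> R -> 'rV[R]_m) :
    Prop :=
  [/\ smooth_family T F,
      (forall t, 0 <= t <= T -> immersion (F ^~ t)) &
      forall (c : chart R n M) (x : M) (t : R),
        atlas c -> chart_dom c x -> 0 <= t <= T ->
        (s - t)^-1 *: (F x s - F x t) @[s --> within `[0, T] t^'] -->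
        mean_curvature (in_chart (F ^~ t) c) (c x)].

Definition bounded_second_fundamental_form (m : nat) (T : R)
    (F : M -> R -> 'rV[R]_m) : Prop :=
  exists2 C0 : R, 0 < C0 &
    forall (c : chart R n M) (x : M) (t : R),
      atlas c -> chart_dom c x -> 0 <= t <= T ->
      sff_norm (in_chart (F ^~ t) c) (c x) <= C0.

End Immersions.

(* Main.v *)
Require Import Defs.
From HB Require Import structures.
From mathcomp Require Import all_boot all_order all_algebra.
From mathcomp Require Import all_classical all_reals all_analysis.
From mathcomp Require Import ring lra.
Set Implicit Arguments.
Unset Strict Implicit.
Unset Printing Implicit Defensive.
Import Order.TTheory GRing.Theory Num.Theory.
Import numFieldNormedType.Exports.
Local Open Scope classical_set_scope.
Local Open Scope ring_scope.

(** The tangent defect of an immersion at a point is the squared Frobenius norm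
    u = |P Om P|^2, where P is the orthogonal projection onto the tangent space
    and Om the matrix of the symplectic form.  It does not depend on the chart,
    it is at most n, and it vanishes exactly at the points where the tangent
    space is Lagrangian ([lagrangianP]).

    Along the flow, u satisfies du/dt <= Delta u + 8 |A|^2 u.  The terms which
    are quadratic in A involve the restriction of Om to the normal space, and
    its norm is controlled by u because Om is orthogonal and the tangent and
    normal spaces have the same dimension: the two diagonal blocks of Om have
    the same Frobenius norm ([frob_complement]).

    The second derivatives of u are never computed.  At a fixed point, with an
    orthonormal tangent frame E and c = E Om E^T, the quantity
    2 <E'^T c E', Om> - |E'^T c E'|^2 is at most u for every tangent frame E'
    and equals u for E' = E ([minorant_le], [minorant_eq]).  It is polynomial
    in E', and it is stationary in the tangential directions, so that only the
    normal part of the evolution of the frame counts.  Along each coordinate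
    line the frame is chosen with covariant derivative zero at the point, and
    then (d/dt - Delta) E is tangential ([normal_evolution]): this is the
    Codazzi equation together with the evolution equation dF/dt = H.

    The maximum principle is applied to
    w = exp(- 8 C0^2 t) u - eps (|F|^2 + (2 n + 1) t), where
    (d/dt - Delta) |F|^2 = - 2 n, which gives (d/dt - Delta) w < 0 and forbids
    a maximum at a positive time ([no_interior_maximum]).  As |H| is bounded,
    points stay at bounded distance from their initial position
    ([displacement_le]); as F0 is proper and u is bounded, w is positive only
    over a compact set, so it would reach a positive maximum
    ([barrier_le0]).  Hence w <= 0, and u = 0 by letting eps tend to 0. *)

(** * Frobenius inner product *)

Section Frobenius.
Variable R : realFieldType.

Definition frob (m n : nat) (A B : 'M[R]_(m, n)) : R := \tr (A *m B^T).

Lemma frobE m n (A B : 'M[R]_(m, n)) : frob A B = \sum_i \sum_j A i j * B i j.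
Proof.
by apply: eq_bigr => i _; rewrite mxE; apply: eq_bigr => j _; rewrite mxE.
Qed.

Lemma frobC m n (A B : 'M[R]_(m, n)) : frob A B = frob B A.
Proof.
by rewrite !frobE; apply: eq_bigr => i _; apply: eq_bigr => j _; rewrite mulrC.
Qed.

Lemma frobDl m n (A B C : 'M[R]_(m, n)) : frob (A + B) C = frob A C + frob B C.
Proof. by rewrite /frob mulmxDl mxtraceD. Qed.

Lemma frobZl m n a (A C : 'M[R]_(m, n)) : frob (a *: A) C = a * frob A C.
Proof. by rewrite /frob -scalemxAl mxtraceZ. Qed.

Lemma frobNl m n (A C : 'M[R]_(m, n)) : frob (- A) C = - frob A C.
Proof. by rewrite -scaleN1r frobZl mulN1r. Qed.

Lemma frob0l m n (C : 'M[R]_(m, n)) : frob 0 C = 0.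
Proof. by rewrite /frob mul0mx mxtrace0. Qed.

Lemma frobBl m n (A B C : 'M[R]_(m, n)) : frob (A - B) C = frob A C - frob B C.
Proof. by rewrite frobDl frobNl. Qed.

Lemma frobDr m n (A B C : 'M[R]_(m, n)) : frob A (B + C) = frob A B + frob A C.
Proof. by rewrite !(frobC A) frobDl. Qed.

Lemma frobZr m n a (A C : 'M[R]_(m, n)) : frob A (a *: C) = a * frob A C.
Proof. by rewrite !(frobC A) frobZl. Qed.

Lemma frobNr m n (A C : 'M[R]_(m, n)) : frob A (- C) = - frob A C.
Proof. by rewrite !(frobC A) frobNl. Qed.

Lemma frobBr m n (A B C : 'M[R]_(m, n)) : frob A (B - C) = frob A B - frob A C.
Proof. by rewrite !(frobC A) frobBl. Qed.

Lemma frob_suml m n (I : finType) (A : I -> 'M[R]_(m, n)) C :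
  frob (\sum_i A i) C = \sum_i frob (A i) C.
Proof. by rewrite /frob mulmx_suml raddf_sum. Qed.

Lemma frob_tr m n (A B : 'M[R]_(m, n)) : frob A^T B^T = frob A B.
Proof. by rewrite /frob trmxK mxtrace_mulC -mxtrace_tr trmx_mul trmxK. Qed.

Lemma frob_mulml m n p (X : 'M[R]_(m, p)) (A : 'M[R]_(p, n)) (B : 'M[R]_(m, n)) :
  frob (X *m A) B = frob A (X^T *m B).
Proof.
by rewrite /frob trmx_mul trmxK -mulmxA mxtrace_mulC -!mulmxA.
Qed.

Lemma frob_mulmr m n p (A : 'M[R]_(m, p)) (X : 'M[R]_(p, n)) (B : 'M[R]_(m, n)) :
  frob (A *m X) B = frob A (B *m X^T).
Proof. by rewrite /frob trmx_mul trmxK mulmxA. Qed.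

Lemma frob_ge0 m n (A : 'M[R]_(m, n)) : 0 <= frob A A.
Proof.
by rewrite frobE; apply: sumr_ge0 => i _; apply: sumr_ge0 => j _;
  rewrite -expr2 sqr_ge0.
Qed.

Lemma frob_eq0 m n (A : 'M[R]_(m, n)) : frob A A = 0 -> A = 0.
Proof.
rewrite frobE => /eqP; rewrite psumr_eq0; last first.
  by move=> i _; apply: sumr_ge0 => j _; rewrite -expr2 sqr_ge0.
move=> /allP A0; apply/matrixP => i j; rewrite mxE.
have /implyP/(_ isT) := A0 i (mem_index_enum _).
rewrite psumr_eq0; last by move=> k _; rewrite -expr2 sqr_ge0.
move=> /allP/(_ j (mem_index_enum _)) /=.
by rewrite mulf_eq0 orbb => /eqP.
Qed.

Lemma frob_entry_le m n (A : 'M[R]_(m, n)) i j : A i j ^+ 2 <= frob A A.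
Proof.
rewrite frobE (bigD1 i)//= (bigD1 j)//= -!expr2 -addrA lerDl addr_ge0//.
  by apply: sumr_ge0 => k _; rewrite -expr2 sqr_ge0.
by apply: sumr_ge0 => k _; apply: sumr_ge0 => l _; rewrite -expr2 sqr_ge0.
Qed.

Lemma frob_CS m n (A B : 'M[R]_(m, n)) :
  frob A B ^+ 2 <= frob A A * frob B B.
Proof.
have [B0|B0] := eqVneq (frob B B) 0.
  by rewrite (frob_eq0 B0) frobC !frob0l expr0n mulr0.
have Bp : 0 < frob B B by rewrite lt_def B0 frob_ge0.
have := frob_ge0 (frob B B *: A - frob A B *: B).
rewrite !(frobBl, frobBr, frobZl, frobZr) (frobC B A).
rewrite (_ : _ - _ = frob B B * (frob A A * frob B B - frob A B ^+ 2)); last by ring.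
by rewrite pmulr_rge0// subr_ge0.
Qed.

Lemma frob_mulmx_le m n p (A : 'M[R]_(m, n)) (B : 'M[R]_(n, p)) :
  frob (A *m B) (A *m B) <= frob A A * frob B B.
Proof.
rewrite -(frob_tr B B) !frobE mulr_suml; apply: ler_sum => i _.
rewrite mulr_sumr; apply: ler_sum => j _; rewrite -expr2.
have := frob_CS (row i A) (col j B)^T.
rewrite frobE big_ord1.
have -> : \sum_k row i A 0 k * (col j B)^T 0 k = (A *m B) i j.
  by rewrite mxE; apply: eq_bigr => k _; rewrite !mxE.
move=> /le_trans; apply; rewrite !frobE !big_ord1 le_eqVlt; apply/orP; left.
by apply/eqP; congr (_ * _); apply: eq_bigr => k _; rewrite !mxE.
Qed.

End Frobenius.

(** * Orthogonal projection onto a row space *)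

(** This is the orthogonal projection onto the row space of [J] when the rows of
    [J] are independent.  It is locked because associativity of the matrix
    product would otherwise rewrite inside it. *)
HB.lock Definition projector (R : realFieldType) (n m : nat)
    (J : 'M[R]_(n, m)) : 'M[R]_m :=
  J^T *m invmx (J *m J^T) *m J.

Section Projector.
Variable R : realFieldType.

Variables n m : nat.
Implicit Types J : 'M[R]_(n, m).

Lemma invmx_congr (G A : 'M[R]_n) : G \in unitmx -> A \in unitmx ->
  A^T *m invmx (A *m G *m A^T) *m A = invmx G.
Proof.
move=> Gu Au; have ATu : A^T \in unitmx by rewrite unitmx_tr.
have Xu : A *m G *m A^T \in unitmx by rewrite !unitmx_mul Au Gu.
suff BG : A^T *m invmx (A *m G *m A^T) *m A *m G = 1%:M.
  by rewrite -[LHS]mulmx1 -(mulmxV Gu) mulmxA BG mul1mx.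
apply: (can_inj (mulmxK ATu)); rewrite mul1mx -!mulmxA (mulmxA A G).
by rewrite mulVmx// mulmx1.
Qed.

Lemma gram_unit J : row_free J -> J *m J^T \in unitmx.
Proof.
move=> Jf; rewrite -row_free_unit -kermx_eq0.
apply/eqP/row_matrixP => i; rewrite row0.
have ki : row i (kermx (J *m J^T)) *m (J *m J^T) = 0.
  by rewrite -row_mul mulmx_ker row0.
set x := row i _ in ki *.
have xJ : x *m J = 0.
  by apply: frob_eq0; rewrite /frob trmx_mul mulmxA -(mulmxA x) ki mul0mx mxtrace0.
by apply: (row_free_inj Jf); rewrite mul0mx.
Qed.

Lemma projector_sym J : (projector J)^T = projector J.
Proof.
rewrite projector.unlock !trmx_mul trmxK trmx_inv trmx_mul trmxK mulmxA.
by [].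
Qed.

Lemma mulmx_projector J : J *m J^T \in unitmx -> J *m projector J = J.
Proof. by move=> Ju; rewrite projector.unlock !mulmxA mulmxV// mul1mx. Qed.

Lemma projector_idem J : J *m J^T \in unitmx ->
  projector J *m projector J = projector J.
Proof.
move=> Ju; have PE : projector J = J^T *m invmx (J *m J^T) *m J.
  by rewrite projector.unlock.
by rewrite {1}PE -mulmxA mulmx_projector.
Qed.

Lemma projector_mul J (A : 'M[R]_n) : J *m J^T \in unitmx -> A \in unitmx ->
  projector (A *m J) = projector J.
Proof.
move=> Ju Au; rewrite projector.unlock trmx_mul -(invmx_congr Ju Au).
by rewrite !mulmxA.
Qed.

Lemma projector_orthonormal J : J *m J^T = 1%:M -> projector J = J^T *m J.
Proof. by move=> JJ; rewrite projector.unlock JJ invmx1 mulmx1. Qed.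

Lemma projector_trace J : J *m J^T \in unitmx -> \tr (projector J) = n%:R.
Proof.
move=> Ju; rewrite projector.unlock mxtrace_mulC mulmxA mulmxV// mxtrace1.
by [].
Qed.

End Projector.

(** * Orthonormal frames *)

Section Cholesky.
Variable R : rcfType.

(** Gaussian elimination with the symmetric pivot [g0], which positivity makes
    nonzero: a shear splits off the first coordinate and leaves the Schur
    complement [H], to which the induction applies. *)
Lemma posdef_congr_id n (G : 'M[R]_n) : G^T = G ->
    (forall x : 'rV[R]_n, x != 0 -> 0 < (x *m G *m x^T) 0 0) ->
  exists2 A : 'M[R]_n, A \in unitmx & A *m G *m A^T = 1%:M.
Proof.
elim: n G => [|n IH] G Gs Gp.
  exists 1%:M; first exact: unitmx1.
  by apply/matrixP => -[].
pose g := @ulsubmx R 1 n 1 n G; pose b := @ursubmx R 1 n 1 n G.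
pose G' := @drsubmx R 1 n 1 n G.
have Gblk : G = @block_mx R 1 n 1 n g b b^T G'.
  rewrite -[LHS](@submxK R 1 n 1 n) /b (@trmx_ursub R 1 n 1 n G) Gs.
  by [].
pose g0 := g 0 0; have gE : g = g0%:M by rewrite [LHS]mx11_scalar.
have G's : G'^T = G' by rewrite /G' trmx_drsub Gs.
have g0p : 0 < g0.
  have := Gp (@row_mx R 1 1 n 1 0).
  rewrite Gblk (@mul_row_block R 1 1 n 1 n) !mul1mx !mul0mx !addr0.
  rewrite (@tr_row_mx R 1 1 n) (@mul_row_col R 1 1 n 1) trmx1 mulmx1 trmx0 mulmx0 addr0.
  apply; apply/eqP; rewrite -(@row_mx0 R 1 1 n) => /(@eq_row_mx R 1 1 n)[/eqP].
  by rewrite oner_eq0.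
pose H := G' - g0^-1 *: (b^T *m b).
pose S : 'M[R]_(1 + n) := @block_mx R 1 n 1 n 1 0 (- g0^-1 *: b^T) 1%:M.
have SGS : S *m G *m S^T = @block_mx R 1 n 1 n g0%:M 0 0 H.
  rewrite Gblk gE /S (@tr_block_mx R 1 n 1 n) !(@mulmx_block R 1 n 1 n 1 n).
  rewrite !trmx1 !trmx0 !mul1mx !mul0mx !mulmx0 !mulmx1 !addr0 !linearZ /=.
  rewrite trmxK !mul_scalar_mx -!scalemxAl !mul_mx_scalar !scalerA.
  rewrite !mulNr mulVf ?gt_eqF// !scaleNr !scale1r !addNr mul0mx.
  by rewrite scaler0 oppr0 add0r addrC.
have Su : S \in unitmx.
  by rewrite unitmxE (@det_lblock R 1 n) !det1 mulr1 unitr1.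
have [|x x0|A Au AH] := IH H.
- by rewrite /H !linearB /= linearZ /= trmx_mul trmxK G's.
- have := Gp ((@row_mx R 1 1 n 0 x : 'rV[R]_(1 + n)) *m S).
  rewrite trmx_mul !mulmxA -(mulmxA _ S G) -(mulmxA _ (S *m G)) SGS.
  rewrite (@mul_row_block R 1 1 n 1 n 0 x g0%:M 0 0 H) !mul0mx !mulmx0 !addr0 !add0r.
  rewrite (@tr_row_mx R 1 1 n) (@mul_row_col R 1 1 n 1) mul0mx add0r; apply.
  apply/eqP => xS0; move/eqP: x0; apply.
  have : @row_mx R 1 1 n 0 x = 0.
    by apply: (can_inj (mulmxK Su)); rewrite xS0 mul0mx.
  by rewrite -(@row_mx0 R 1 1 n) => /(@eq_row_mx R 1 1 n)[_ ->].
exists ((@block_mx R 1 n 1 n (Num.sqrt g0)^-1%:M 0 0 A : 'M[R]_(1 + n)) *m S).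
  rewrite unitmx_mul Su andbT unitmxE (@det_lblock R 1 n) det_scalar1.
  by rewrite unitrM unitfE invr_eq0 sqrtr_eq0 -ltNge g0p -unitmxE.
rewrite trmx_mul !mulmxA -(mulmxA _ S G) -(mulmxA _ (S *m G)) SGS.
rewrite (@tr_block_mx R 1 n 1 n) !(@mulmx_block R 1 n 1 n 1 n) !trmx0.
rewrite !mulmx0 !mul0mx !addr0 !add0r !mul0mx AH tr_scalar_mx.
rewrite -!scalar_mxM mulrAC -invfM -expr2 sqr_sqrtr ?ltW// mulVf ?gt_eqF//.
by rewrite -(@scalar_mx_block R 1 n 1).
Qed.

Lemma orthonormal_frame n m (J : 'M[R]_(n, m)) : row_free J ->
  exists2 A : 'M[R]_n, A \in unitmx & (A *m J) *m (A *m J)^T = 1%:M.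
Proof.
move=> Jf; have [|x x0|A Au AJ] := @posdef_congr_id n (J *m J^T).
- by rewrite trmx_mul trmxK.
- have -> : (x *m (J *m J^T) *m x^T) 0 0 = frob (x *m J) (x *m J).
    by rewrite /frob trmx_mul !mulmxA [RHS]/mxtrace big_ord1.
  rewrite lt_def frob_ge0 andbT; apply/eqP => /frob_eq0 xJ.
  by move/eqP: x0; apply; apply: (row_free_inj Jf); rewrite mul0mx.
- by exists A => //; rewrite trmx_mul !mulmxA in AJ *.
Qed.

End Cholesky.

(** * The defect of a subspace with respect to a form *)

Section Defect.
Variables (R : realFieldType) (m : nat) (Om : 'M[R]_m).

Definition defect n (J : 'M[R]_(n, m)) : R :=
  frob (projector J *m Om *m projector J) (projector J *m Om *m projector J).

(** By completing the square, <X, X> is the largest value of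
    2 <X, Y> - <Y, Y> when Y varies.  Here X is the form compressed to the
    tangent space and Y = E^T c E; the point of this expression is that it does
    not contain the inverse of the metric. *)
Definition minorant n (c : 'M[R]_n) (E : 'M[R]_(n, m)) : R :=
  2 * frob (E^T *m c *m E) Om - frob (E^T *m c *m E) (E^T *m c *m E).

(** First derivative of [minorant] at [E] in the direction [K]. *)
Definition minorant_diff n (c : 'M[R]_n) (E K : 'M[R]_(n, m)) : R :=
  2 * frob (K^T *m c *m E + E^T *m c *m K) (Om - E^T *m c *m E).

(** Second derivative of [minorant] along a curve which is at [E] with velocity
    [N] and acceleration [M]. *)
Definition minorant_diff2 n (c : 'M[R]_n) (E N M : 'M[R]_(n, m)) : R :=
  2 * (frob (M^T *m c *m E + 2 *: (N^T *m c *m N) + E^T *m c *m M)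
        (Om - E^T *m c *m E)
    - frob (N^T *m c *m E + E^T *m c *m N) (N^T *m c *m E + E^T *m c *m N)).

Lemma frob_compress (P X : 'M[R]_m) : P^T = P -> P *m X = X -> X *m P = X ->
  frob X Om = frob X (P *m Om *m P).
Proof. by move=> Ps PX XP; rewrite -{1}PX -{1}XP frob_mulml frob_mulmr Ps. Qed.

Lemma minorant_le n (c : 'M[R]_n) (J : 'M[R]_(n, m)) (A : 'M[R]_n) :
  J *m J^T \in unitmx -> minorant c (A *m J) <= defect J.
Proof.
move=> Ju; rewrite /minorant; set Z := _ *m c *m _.
have JP := mulmx_projector Ju; have Ps := projector_sym J.
have ZP : Z *m projector J = Z by rewrite /Z -!mulmxA JP.
have PZ : projector J *m Z = Z.
  by rewrite -[X in X *m Z]Ps /Z !mulmxA -trmx_mul -(mulmxA A J) JP.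
rewrite (frob_compress Ps PZ ZP).
have := frob_ge0 (Z - projector J *m Om *m projector J).
rewrite !(frobBl, frobBr) -/(defect J) (frobC _ Z); lra.
Qed.

Lemma minorant_eq n (E : 'M[R]_(n, m)) : E *m E^T = 1%:M ->
  minorant (E *m Om *m E^T) E = defect E.
Proof.
move=> EE; have Eu : E *m E^T \in unitmx by rewrite EE unitmx1.
have Pi := projector_idem Eu; have Ps := projector_sym E.
rewrite /minorant /defect (_ : _ *m E = projector E *m Om *m projector E).
  pose X := projector E *m Om *m projector E; have PX : projector E *m X = X by rewrite /X !mulmxA Pi.
  have XP : X *m projector E = X by rewrite /X -mulmxA Pi.
  by rewrite (frob_compress Ps PX XP); lra.
by rewrite (projector_orthonormal EE) !mulmxA.
Qed.

Lemma defect_orthonormal n (E : 'M[R]_(n, m)) : E *m E^T = 1%:M ->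
  defect E = frob (E *m Om *m E^T) (E *m Om *m E^T).
Proof.
move=> EE; rewrite /defect (projector_orthonormal EE).
have -> : E^T *m E *m Om *m (E^T *m E) = E^T *m ((E *m Om *m E^T) *m E).
  by rewrite !mulmxA.
rewrite frob_mulml trmxK mulmxA EE mul1mx.
by rewrite frob_mulmr -(mulmxA _ E) EE mulmx1.
Qed.

Section Complement.
Variable P : 'M[R]_m.
Hypotheses (Ps : P^T = P) (Pi : P *m P = P) (Omu : Om *m Om^T = 1%:M).

(** Both sides compute |Q Om|^2, on the left because Om is orthogonal and on the
    right by Pythagoras. *)
Lemma frob_split_form (Q : 'M[R]_m) : Q^T = Q -> Q *m Q = Q ->
  \tr Q = frob (Q *m Om *m P) (Q *m Om *m P) +
          frob (Q *m Om *m (1%:M - P)) (Q *m Om *m (1%:M - P)).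
Proof.
move=> Qs Qi.
have -> : \tr Q = frob (Q *m Om) (Q *m Om).
  by rewrite /frob trmx_mul mulmxA -(mulmxA Q) Omu mulmx1 Qs Qi.
have P's : (1%:M - P)^T = 1%:M - P by rewrite linearB /= trmx1 Ps.
have P'i : (1%:M - P) *m (1%:M - P) = 1%:M - P.
  by rewrite mulmxBr mulmx1 mulmxBl mul1mx Pi subrr subr0.
move: (Q *m Om) => Y; rewrite !(frob_mulmr Y) Ps P's -frobDr.
by rewrite -!mulmxA Pi P'i -mulmxDr addrC subrK mulmx1.
Qed.

Hypothesis Oma : Om^T = - Om.

(** The off-diagonal blocks P Om P' and P' Om P are opposite transposes of each
    other, so they have the same norm; as P and P' = 1 - P have the same trace,
    [frob_split_form] leaves the same amount to the two diagonal blocks. *)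
Lemma frob_complement : \tr P = \tr (1%:M - P) ->
  frob ((1%:M - P) *m Om *m (1%:M - P)) ((1%:M - P) *m Om *m (1%:M - P)) =
  frob (P *m Om *m P) (P *m Om *m P).
Proof.
move=> trP; set Q := 1%:M - P.
have Qs : Q^T = Q by rewrite /Q linearB /= trmx1 Ps.
have Qi : Q *m Q = Q.
  by rewrite /Q mulmxBr mulmx1 mulmxBl mul1mx Pi subrr subr0.
have := frob_split_form Ps Pi; rewrite trP (frob_split_form Qs Qi) -/Q.
have -> : frob (Q *m Om *m P) (Q *m Om *m P) = frob (P *m Om *m Q) (P *m Om *m Q).
  by rewrite -frob_tr !trmx_mul Oma Ps Qs mulNmx mulmxN frobNl frobNr opprK mulmxA.
by rewrite addrC => /addIr.
Qed.

End Complement.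

Lemma defect_le n (J : 'M[R]_(n, m)) : Om *m Om^T = 1%:M ->
  J *m J^T \in unitmx -> defect J <= n%:R.
Proof.
move=> Omu Ju; rewrite -(projector_trace Ju).
rewrite (@frob_split_form (projector J) (projector_sym J) (projector_idem Ju) Omu
  _ (projector_sym J) (projector_idem Ju)).
by rewrite /defect lerDl frob_ge0.
Qed.

Lemma defect_eq0 n (J : 'M[R]_(n, m)) : J *m J^T \in unitmx ->
  (defect J == 0) = (J *m Om *m J^T == 0).
Proof.
move=> Ju; apply/eqP/eqP => [/frob_eq0 D0|J0].
  have JP := mulmx_projector Ju.
  rewrite -[X in X *m Om]JP -[X in X^T]JP trmx_mul projector_sym.
  by rewrite !mulmxA -!(mulmxA J) D0 mul0mx mulmx0.
have -> : defect J = frob (J^T *m invmx (J *m J^T) *m (J *m Om *m J^T) *m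
    invmx (J *m J^T) *m J) (projector J *m Om *m projector J).
  by rewrite /defect projector.unlock !mulmxA.
by rewrite J0 !(mul0mx, mulmx0) frob0l.
Qed.

Lemma defect_ge0 n (J : 'M[R]_(n, m)) : 0 <= defect J.
Proof. exact: frob_ge0. Qed.

End Defect.

(** * Evolution inequality for the defect: algebraic part *)

Section Evolution.
Variables (R : realFieldType) (n : nat).
Local Notation m := (n + n)%N.
Variables (Om : 'M[R]_m) (E : 'M[R]_(n, m)).
Hypotheses (Omu : Om *m Om^T = 1%:M) (Oma : Om^T = - Om).
Hypothesis EE : E *m E^T = 1%:M.

Variable c : 'M[R]_n.
Hypothesis cE : c = E *m Om *m E^T.
Local Notation Z := (E^T *m c *m E).

Let ca : c^T = - c.
Proof. by rewrite cE !trmx_mul trmxK Oma mulNmx mulmxN mulmxA. Qed.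

Let Za : Z^T = - Z.
Proof. by rewrite !trmx_mul trmxK ca mulNmx mulmxN mulmxA. Qed.

Lemma minorant_diffE K : minorant_diff Om c E K =
  4 * frob (c *m K) (E *m (Om - Z)).
Proof.
rewrite /minorant_diff frobDl.
have -> : frob (K^T *m c *m E) (Om - Z) = frob (E^T *m c *m K) (Om - Z).
  have OZa : (Om - Z)^T = - (Om - Z) by rewrite linearB /= Oma Za opprK opprB addrC.
  by rewrite -frob_tr OZa !trmx_mul trmxK ca mulNmx mulmxN frobNl frobNr opprK mulmxA.
by rewrite -mulmxA frob_mulml trmxK; lra.
Qed.

Lemma normal_defect_form_tangent : E *m (Om - Z) *m E^T = 0.
Proof.
rewrite mulmxBr mulmxBl !mulmxA EE mul1mx -cE.
by rewrite -mulmxA EE mulmx1 subrr.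
Qed.

(** The minorant is maximal at [E] among the frames of the same subspace, so that
    tangential variations do not change it to first order. *)
Lemma minorant_diff_tan K : K *m (1%:M - projector E) = 0 ->
  minorant_diff Om c E K = 0.
Proof.
rewrite mulmxBr mulmx1 => /eqP; rewrite subr_eq0 => /eqP ->.
rewrite minorant_diffE (projector_orthonormal EE) !mulmxA.
by rewrite frob_mulmr normal_defect_form_tangent /frob trmx0 mulmx0 mxtrace0 mulr0.
Qed.

Lemma minorant_diffD K L : minorant_diff Om c E (K + L) =
  minorant_diff Om c E K + minorant_diff Om c E L.
Proof. by rewrite !minorant_diffE mulmxDr frobDl mulrDr. Qed.

Lemma minorant_diffZ a K : minorant_diff Om c E (a *: K) =
  a * minorant_diff Om c E K.
Proof. by rewrite !minorant_diffE -scalemxAr frobZl mulrCA. Qed.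

Lemma minorant_diff_sum (I : finType) (K : I -> 'M[R]_(n, m)) :
  minorant_diff Om c E (\sum_i K i) = \sum_i minorant_diff Om c E (K i).
Proof.
rewrite minorant_diffE mulmx_sumr frob_suml mulr_sumr.
by apply: eq_bigr => i _; rewrite minorant_diffE.
Qed.

Lemma minorant_diff2E N M : N *m E^T = 0 ->
  minorant_diff2 Om c E N M =
    minorant_diff Om c E M + 4 * frob c (N *m Om *m N^T) - 4 * frob (c *m N) (c *m N).
Proof.
move=> NE.
have EN : E *m N^T = 0 by rewrite -[LHS]trmxK trmx_mul trmxK NE trmx0.
rewrite /minorant_diff2 /minorant_diff addrAC frobDl frobZl.
have -> : frob (N^T *m c *m N) (Om - Z) = frob c (N *m Om *m N^T).
  rewrite frob_mulmr frob_mulml trmxK mulmxBl mulmxBr.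
  by rewrite !mulmxA NE !mul0mx subr0.
have -> : frob (N^T *m c *m E + E^T *m c *m N) (N^T *m c *m E + E^T *m c *m N)
  = 2 * frob (c *m N) (c *m N).
  have EcN : frob (E^T *m c *m N) (E^T *m c *m N) = frob (c *m N) (c *m N).
    by rewrite -mulmxA frob_mulml trmxK mulmxA EE mul1mx.
  have cross : frob (N^T *m c *m E) (E^T *m c *m N) = 0.
    by rewrite frob_mulmr -!mulmxA NE !mulmx0 frobC frob0l.
  have NcE : frob (N^T *m c *m E) (N^T *m c *m E) = frob (c *m N) (c *m N).
    rewrite -EcN -frob_tr !trmx_mul trmxK ca mulNmx mulmxN frobNl frobNr opprK.
    by rewrite mulmxA.
  by rewrite frobDl !frobDr (frobC (E^T *m c *m N) (N^T *m c *m E)) cross NcE EcN; lra.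
lra.
Qed.

(** The left-hand side only involves the restriction of the form to the normal
    space, whose norm is the norm of [c] by [frob_complement]. *)
Lemma frob_normal_form N : N *m E^T = 0 ->
  - frob c (N *m Om *m N^T) <= frob c c * frob N N.
Proof.
move=> NE; have Eu : E *m E^T \in unitmx by rewrite EE unitmx1.
pose Q := 1%:M - projector E.
have Qs : Q^T = Q by rewrite /Q linearB /= trmx1 projector_sym.
have NQ : N *m Q = N.
  by rewrite /Q mulmxBr mulmx1 (projector_orthonormal EE) mulmxA NE mul0mx subr0.
have NOm : N *m Om *m N^T = N *m (Q *m Om *m Q) *m N^T.
  by rewrite -[in LHS]NQ trmx_mul Qs !mulmxA.
have trQ : \tr (projector E) = \tr (1%:M - projector E).
  by rewrite raddfB /= mxtrace1 (projector_trace Eu) natrD; lra.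
have QOQ : frob (Q *m Om *m Q) (Q *m Om *m Q) = frob c c.
  rewrite (frob_complement (projector_sym E) (projector_idem Eu) Omu Oma trQ).
  by rewrite -/(defect Om E) (defect_orthonormal _ EE) cE.
have sq : frob c (N *m Om *m N^T) ^+ 2 <= (frob c c * frob N N) ^+ 2.
  apply: le_trans (frob_CS _ _) _.
  rewrite exprMn expr2 -mulrA; apply: ler_wpM2l; first exact: frob_ge0.
  rewrite NOm; apply: le_trans (frob_mulmx_le _ _) _.
  rewrite frob_tr expr2 mulrA; apply: ler_wpM2r; first exact: frob_ge0.
  by apply: le_trans (frob_mulmx_le _ _) _; rewrite QOQ mulrC.
have pos : 0 <= frob c c * frob N N by rewrite mulr_ge0// frob_ge0.
have : `|frob c (N *m Om *m N^T)| <= frob c c * frob N N.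
  by rewrite -ler_sqr ?nnegrE// real_normK ?num_real.
by rewrite ler_norml => /andP[+ _]; rewrite lerNl.
Qed.

(** The reaction term of the evolution of the defect.  [D] stands for the time
    derivative of the frame, [N j] and [M j] for its first and second derivatives
    along the j-th line, and [X] for the first-order coefficients of the
    Laplacian.  The hypothesis says that the frame solves the heat equation up
    to tangential terms; what remains is the part of the second derivatives
    that is quadratic in the second fundamental form. *)
Lemma minorant_evolution (D : 'M[R]_(n, m)) (N M : 'I_n -> 'M[R]_(n, m))
    (X : 'I_n -> R) (B : R) :
    (forall j, N j *m E^T = 0) ->
    (D - \sum_j M j + \sum_j X j *: N j) *m (1%:M - projector E) = 0 ->
    \sum_j frob (N j) (N j) <= B ->
  minorant_diff Om c E D - \sum_j minorant_diff2 Om c E (N j) (M j)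
    + \sum_j X j * minorant_diff Om c E (N j) <= 8 * B * frob c c.
Proof.
move=> NE /minorant_diff_tan; rewrite !minorant_diffD minorant_diff_sum.
rewrite -scaleN1r minorant_diffZ minorant_diff_sum mulN1r => D0 NB.
under [X in _ - X]eq_bigr do rewrite minorant_diff2E//.
have -> : \sum_j X j * minorant_diff Om c E (N j) =
    \sum_j minorant_diff Om c E (X j *: N j).
  by apply: eq_bigr => j _; rewrite minorant_diffZ.
rewrite sumrB big_split /=.
have c0 := frob_ge0 c.
suff : \sum_j (4 * frob (c *m N j) (c *m N j) - 4 * frob c (N j *m Om *m (N j)^T))
   <= 8 * B * frob c c.
  by rewrite sumrB; move: D0; lra.
apply: (@le_trans _ _ (\sum_j 8 * frob c c * frob (N j) (N j))).
  apply: ler_sum => j _; have := frob_normal_form (NE j).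
  have := frob_mulmx_le c (N j); lra.
by rewrite -mulr_sumr [leRHS]mulrAC; apply: ler_wpM2l => //; rewrite mulr_ge0.
Qed.

End Evolution.

(** * Entrywise limits of matrices *)

Section MatrixLimits.
Context {R : realType} {T : Type} (F : set_system T) {FF : Filter F}.

Definition mx_cvg m n (A : T -> 'M[R]_(m, n)) (A0 : 'M[R]_(m, n)) : Prop :=
  forall i j, A x i j @[x --> F] --> A0 i j.

Lemma cvg_sum_fin (I : finType) (P : pred I) (f : I -> T -> R) (l : I -> R) :
  (forall i, P i -> f i x @[x --> F] --> l i) ->
  \sum_(i | P i) f i x @[x --> F] --> \sum_(i | P i) l i.
Proof. by move=> fl; apply: cvg_big => //; exact: add_continuous. Qed.

Lemma cvg_prod_fin (I : finType) (P : pred I) (f : I -> T -> R) (l : I -> R) :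
  (forall i, P i -> f i x @[x --> F] --> l i) ->
  \prod_(i | P i) f i x @[x --> F] --> \prod_(i | P i) l i.
Proof. by move=> fl; apply: cvg_big => //; exact: mul_continuous. Qed.

Lemma mx_cvg_cst m n (A : 'M[R]_(m, n)) : mx_cvg (fun=> A) A.
Proof. by move=> i j; exact: cvg_cst. Qed.

Lemma mx_cvg_mul m n p (A : T -> 'M[R]_(m, n)) (B : T -> 'M[R]_(n, p)) A0 B0 :
  mx_cvg A A0 -> mx_cvg B B0 -> mx_cvg (fun x => A x *m B x) (A0 *m B0).
Proof.
move=> cA cB i j; rewrite mxE; under eq_fun do rewrite mxE.
by apply: cvg_sum_fin => k _; apply: cvgM.
Qed.

Lemma mx_cvg_tr m n (A : T -> 'M[R]_(m, n)) A0 :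
  mx_cvg A A0 -> mx_cvg (fun x => (A x)^T) A0^T.
Proof. by move=> cA i j; rewrite mxE; under eq_fun do rewrite mxE; exact: cA. Qed.

Lemma cvg_det n (A : T -> 'M[R]_n) A0 :
  mx_cvg A A0 -> \det (A x) @[x --> F] --> \det A0.
Proof.
move=> cA; apply: cvg_sum_fin => s _; apply: cvgM; first exact: cvg_cst.
by apply: cvg_prod_fin => i _.
Qed.

Lemma cvg_unitmx n (A : T -> 'M[R]_n) A0 : A0 \in unitmx ->
  mx_cvg A A0 -> \forall x \near F, A x \in unitmx.
Proof.
rewrite unitmxE unitfE => A0u /cvg_det dA.
have : \forall x \near F, \det (A x) != 0 by exact: cvgr_neq0 dA A0u.
by apply: filterS => x; rewrite unitmxE unitfE.
Qed.

Lemma mx_cvg_inv n (A : T -> 'M[R]_n) A0 : A0 \in unitmx ->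
  mx_cvg A A0 -> mx_cvg (fun x => invmx (A x)) (invmx A0).
Proof.
move=> A0u cA i j; have Au := cvg_unitmx A0u cA.
have : (\det (A x))^-1 * (\adj (A x)) i j @[x --> F] --> invmx A0 i j.
  rewrite /invmx A0u mxE; apply: cvgM.
    by apply: cvgV; [move: A0u; rewrite unitmxE unitfE|exact: cvg_det].
  rewrite mxE; under eq_fun do rewrite mxE.
  apply: cvgM; first exact: cvg_cst.
  by apply: cvg_det => k l; rewrite !mxE; under eq_fun do rewrite !mxE; exact: cA.
apply: cvg_trans; apply: near_eq_cvg; near=> x.
have -> : invmx (A x) = (\det (A x))^-1 *: \adj (A x).
  by rewrite /invmx (near Au x _).
by rewrite [RHS]mxE.
Unshelve. all: by end_near. Qed.

Lemma cvg_frob m n (A B : T -> 'M[R]_(m, n)) A0 B0 :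
  mx_cvg A A0 -> mx_cvg B B0 -> frob (A x) (B x) @[x --> F] --> frob A0 B0.
Proof.
move=> cA cB; rewrite frobE; under eq_fun do rewrite frobE.
by apply: cvg_sum_fin => i _; apply: cvg_sum_fin => j _; apply: cvgM.
Qed.

Lemma cvg_defect m (Om : 'M[R]_m) n (J : T -> 'M[R]_(n, m)) J0 :
  J0 *m J0^T \in unitmx -> mx_cvg J J0 ->
  defect Om (J x) @[x --> F] --> defect Om J0.
Proof.
move=> J0u cJ.
have cP : mx_cvg (fun x => projector (J x)) (projector J0).
  rewrite projector.unlock; apply: mx_cvg_mul => //; apply: mx_cvg_mul.
    exact: mx_cvg_tr.
  by apply: mx_cvg_inv => //; apply: mx_cvg_mul => //; exact: mx_cvg_tr.
by apply: cvg_frob; apply: mx_cvg_mul => //; apply: mx_cvg_mul => //;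
  exact: mx_cvg_cst.
Qed.

End MatrixLimits.

(** * Entrywise derivatives of matrices *)

Section MatrixDerivatives.
Context {R : realType}.
Implicit Type x : R.

Definition mx_derive m n (A : R -> 'M[R]_(m, n)) x (A' : 'M[R]_(m, n)) : Prop :=
  forall i j, is_derive x 1 (fun s => A s i j) (A' i j).

Lemma is_deriveP {V W : normedModType R} (f : V -> W) (x v : V) (l : W) :
  is_derive x v f l <->
  h^-1 *: (f (h *: v + x) - f x) @[h --> 0^'] --> l.
Proof.
split=> [[fx <-]|fl]; first exact: fx.
by split; [apply/cvg_ex; exists l|apply/cvg_lim].
Qed.

Lemma is_derive_ext {V W : normedModType R} (f g : V -> W) (x v : V) (l : W) :
  (forall y, f y = g y) -> is_derive x v f l -> is_derive x v g l.
Proof. by move=> /funext ->. Qed.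

Lemma is_derive_mulf (f g : R -> R) x a b :
  is_derive x 1 f a -> is_derive x 1 g b ->
  is_derive x 1 (fun s => f s * g s) (a * g x + f x * b).
Proof.
move=> fa gb; apply: (is_derive_eq (is_deriveM fa gb)).
by rewrite addrC /= /GRing.scale /= mulrC.
Qed.

Lemma is_derive_addf (f g : R -> R) x a b :
  is_derive x 1 f a -> is_derive x 1 g b ->
  is_derive x 1 (fun s => f s + g s) (a + b).
Proof. by move=> fa gb; exact: is_deriveD. Qed.

Lemma is_derive_oppf (f : R -> R) x a :
  is_derive x 1 f a -> is_derive x 1 (fun s => - f s) (- a).
Proof. by move=> fa; exact: is_deriveN. Qed.

Lemma is_derive_mulcf (k : R) (f : R -> R) x a :
  is_derive x 1 f a -> is_derive x 1 (fun s => k * f s) (k * a).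
Proof. by move=> fa; exact: is_deriveZ. Qed.

Lemma is_derive_sum_fin (I : finType) (f : I -> R -> R) x (df : I -> R) :
  (forall i, is_derive x 1 (f i) (df i)) ->
  is_derive x 1 (fun s => \sum_i f i s) (\sum_i df i).
Proof.
move=> fd; elim: (index_enum I) => [|i r IH].
  rewrite big_nil; apply: (is_derive_ext _ (is_derive_cst 0 x 1)).
  by move=> y; rewrite big_nil.
rewrite big_cons; apply: (is_derive_ext _ (is_derive_addf (fd i) IH)).
by move=> y; rewrite big_cons.
Qed.

Lemma mx_derive_ext m n (A B : R -> 'M[R]_(m, n)) x A' :
  (forall s, A s = B s) -> mx_derive A x A' -> mx_derive B x A'.
Proof. by move=> /funext ->. Qed.

Lemma mx_derive_cst m n (A : 'M[R]_(m, n)) x : mx_derive (fun=> A) x 0.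
Proof. by move=> i j; rewrite mxE; exact: is_derive_cst. Qed.

Lemma mx_derive_add m n (A B : R -> 'M[R]_(m, n)) x A' B' :
  mx_derive A x A' -> mx_derive B x B' ->
  mx_derive (fun s => A s + B s) x (A' + B').
Proof.
move=> dA dB i j; rewrite mxE; apply: (is_derive_ext _ (is_derive_addf (dA i j) (dB i j))).
by move=> s; rewrite mxE.
Qed.

Lemma mx_derive_opp m n (A : R -> 'M[R]_(m, n)) x A' :
  mx_derive A x A' -> mx_derive (fun s => - A s) x (- A').
Proof.
move=> dA i j; rewrite mxE; apply: (is_derive_ext _ (is_derive_oppf (dA i j))).
by move=> s; rewrite mxE.
Qed.

Lemma mx_derive_scale m n (f : R -> R) (A : R -> 'M[R]_(m, n)) x f' A' :
  is_derive x 1 f f' -> mx_derive A x A' ->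
  mx_derive (fun s => f s *: A s) x (f' *: A x + f x *: A').
Proof.
move=> df dA i j; rewrite !mxE; apply: (is_derive_ext _ (is_derive_mulf df (dA i j))).
by move=> s; rewrite mxE.
Qed.

Lemma mx_derive_sum m n (I : finType) (A : I -> R -> 'M[R]_(m, n)) x
    (A' : I -> 'M[R]_(m, n)) : (forall i, mx_derive (A i) x (A' i)) ->
  mx_derive (fun s => \sum_i A i s) x (\sum_i A' i).
Proof.
move=> dA i j; rewrite summxE.
apply: (is_derive_ext _ (is_derive_sum_fin (fun k => dA k i j))).
by move=> s; rewrite summxE.
Qed.

Lemma mx_derive_tr m n (A : R -> 'M[R]_(m, n)) x A' :
  mx_derive A x A' -> mx_derive (fun s => (A s)^T) x A'^T.
Proof.
move=> dA i j; rewrite mxE; apply: (is_derive_ext _ (dA j i)).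
by move=> s; rewrite mxE.
Qed.

Lemma mx_derive_mul m n p (A : R -> 'M[R]_(m, n)) (B : R -> 'M[R]_(n, p)) x A' B' :
  mx_derive A x A' -> mx_derive B x B' ->
  mx_derive (fun s => A s *m B s) x (A' *m B x + A x *m B').
Proof.
move=> dA dB i j; rewrite !mxE -big_split /=.
apply: (is_derive_ext _ (is_derive_sum_fin
  (fun k => is_derive_mulf (dA i k) (dB k j)))).
by move=> s; rewrite mxE.
Qed.

Lemma is_derive_frob m n (A B : R -> 'M[R]_(m, n)) x A' B' :
  mx_derive A x A' -> mx_derive B x B' ->
  is_derive x 1 (fun s => frob (A s) (B s)) (frob A' (B x) + frob (A x) B').
Proof.
move=> dA dB; rewrite !frobE -big_split /=.
under eq_bigr do rewrite -big_split /=.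
apply: (is_derive_ext _ (is_derive_sum_fin (fun i => is_derive_sum_fin
  (fun j => is_derive_mulf (dA i j) (dB i j))))).
by move=> s; rewrite frobE.
Qed.

Lemma cvg_shift_dnbhs {V : normedModType R} (v x : V) :
  h *: v + x @[h --> (0 : R)^'] --> x.
Proof.
apply: cvg_within_filter.
have : h *: v + x @[h --> (0 : R)] --> 0 *: v + x.
  by apply: cvgD; [apply: cvgZr_tmp; exact: cvg_id|exact: cvg_cst].
by rewrite scale0r add0r.
Qed.

Lemma mx_derive_cvg m n (A : R -> 'M[R]_(m, n)) x A' : mx_derive A x A' ->
  mx_cvg (nbhs x) A (A x).
Proof.
move=> dA i j.
apply: (@differentiable_continuous _ _ _ x (fun s => A s i j)).
by apply/derivable1_diffP; case: (dA i j).
Qed.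

(** The difference quotient of the inverse is
    - A(x+h)^-1 ((A(x+h) - A(x)) / h) A(x)^-1, so continuity of the inverse
    suffices. *)
Lemma mx_derive_inv n (A : R -> 'M[R]_n) x A' : A x = 1%:M ->
  mx_derive A x A' -> mx_derive (fun s => invmx (A s)) x (- A').
Proof.
move=> A1 dA i j; apply/is_deriveP.
have cA : mx_cvg ((0 : R)^') (fun h => A (h *: 1 + x)) 1%:M.
  move=> k l; rewrite -A1.
  exact: (cvg_comp _ _ (@cvg_shift_dnbhs R^o 1 x) (@mx_derive_cvg _ _ _ _ _ dA k l)).
have cI : mx_cvg ((0 : R)^') (fun h => invmx (A (h *: 1 + x))) 1%:M.
  by rewrite -[X in mx_cvg _ _ X](invmx1 R n); apply: mx_cvg_inv => //; exact: unitmx1.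
have cQ : mx_cvg ((0 : R)^') (fun h => h^-1 *: (A (h *: 1 + x) - A x)) A'.
  move=> k l; have /is_deriveP := dA k l.
  by apply: cvg_trans; apply: near_eq_cvg; apply: nearW => h; rewrite !mxE.
have cP : mx_cvg ((0 : R)^') (fun h => invmx (A (h *: 1 + x)) *m
    ((h^-1 *: (A (h *: 1 + x) - A x)) *m (-1)%:M)) (1%:M *m (A' *m (-1)%:M)).
  by apply: mx_cvg_mul => //; apply: mx_cvg_mul => //; exact: mx_cvg_cst.
have := cP i j; rewrite mul1mx mul_mx_scalar scaleN1r.
apply: cvg_trans; apply: near_eq_cvg.
have : \forall h \near (0 : R)^', A (h *: 1 + x) \in unitmx.
  by apply: cvg_unitmx cA; exact: unitmx1.
apply: filterS => h Au.
rewrite A1 invmx1 mul_mx_scalar scaleN1r mulmxN -scalemxAr mulmxBr mulVmx// mulmx1.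
by rewrite !mxE -mulrN opprB.
Qed.

End MatrixDerivatives.

(** * Maxima of functions of one variable *)

Section OneVariable.
Context {R : realType}.
Implicit Types (phi dphi : R -> R) (x l : R).

Lemma dnbhs0_pos (P : R -> Prop) : (\forall h \near 0^', P h) ->
  exists2 e : R, 0 < e & forall h, h != 0 -> `|h| < e -> P h.
Proof.
move=> /nbhs_ballP[e /= e0 He]; exists e => // h h0 he; apply: He => //.
by rewrite /ball /= sub0r normrN.
Qed.

Lemma nbhs_pos (P : R -> Prop) x : (\forall s \near x, P s) ->
  exists2 e : R, 0 < e & forall s, `|s - x| < e -> P s.
Proof.
move=> /nbhs_ballP[e /= e0 He]; exists e => // s se; apply: He => //.
by rewrite /ball /= distrC.
Qed.

(** One-sided maximum: the maximum in time is only known with respect to the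
    past. *)
Lemma left_max_derive phi x l : is_derive x 1 phi l ->
  (\forall s \near x, s <= x -> phi s <= phi x) -> 0 <= l.
Proof.
move=> /is_deriveP qphi /nbhs_pos[e e0 He]; rewrite leNgt; apply/negP => l0.
have Q := cvgr_lt _ qphi _ l0.
have [d d0 Hd] := dnbhs0_pos (Q _).
have m0 : 0 < Num.min e d by rewrite lt_min e0 d0.
pose h := - (Num.min e d / 2).
have h0 : h < 0 by rewrite oppr_lt0 divr_gt0.
have hm : `|h| < Num.min e d.
  by rewrite normrN gtr0_norm ?divr_gt0// ltr_pdivrMr// ltr_pMr// ltr1n.
move: hm; rewrite lt_min => /andP[he hd].
have := Hd h (ltr0_neq0 h0) hd; rewrite ltNge => /negP; apply.
rewrite /GRing.scale /= mulr_le0//; first by rewrite invr_le0 ltW.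
by rewrite subr_le0 mulr1 He ?addrK// gerDr ltW.
Qed.

Lemma second_derivative_max phi phi' x l :
  (\forall s \near x, is_derive (s : R) (1 : R) phi (phi' s)) -> is_derive x 1 phi' l ->
  (\forall s \near x, phi s <= phi x) -> phi' x = 0 /\ l <= 0.
Proof.
move=> /nbhs_pos[e e0 He] dl /nbhs_pos[d d0 Hd].
have m0 : 0 < Num.min e d by rewrite lt_min e0 d0.
set r := Num.min e d in m0.
have Hr s : `|s - x| < r -> is_derive s 1 phi (phi' s) /\ phi s <= phi x.
  by rewrite lt_min => /andP[/He ? /Hd].
have phi'0 : phi' x = 0.
  have itvr s : s \in `](x - r), (x + r)[ -> `|s - x| < r.
    by rewrite in_itv /= => /andP[? ?]; rewrite ltr_distl; apply/andP; split; lra.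
  have [|s /itvr /Hr[] //|||_ <-] := @derive1_at_max R phi (x - r) (x + r) x.
  - lra.
  - by rewrite in_itv /=; apply/andP; split; lra.
  - by move=> s /itvr /Hr[].
  by have [|? _] := Hr x; [rewrite subrr normr0|rewrite derive_val].
split=> //; rewrite leNgt; apply/negP => l0.
have /is_deriveP qphi := dl.
have Q := cvgr_gt _ qphi _ l0.
have [f f0 Hf] := dnbhs0_pos (Q _).
have n0 : 0 < Num.min r f by rewrite lt_min m0 f0.
pose h := Num.min r f / 2.
have h0 : 0 < h by rewrite divr_gt0.
have : h < Num.min r f by rewrite ltr_pdivrMr// ltr_pMr// ltr1n.
rewrite lt_min => /andP[hr hf].
have near_x s : s \in `[x, x + h] -> `|s - x| < r.
  by rewrite in_itv /= => /andP[? ?]; rewrite ger0_norm; lra.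
have [|s sxh||c] := @MVT R phi phi' x (x + h).
- lra.
- by have [] := Hr s (near_x _ (subset_itv_oo_cc sxh)).
- apply: continuous_in_subspaceT => s; rewrite inE /= => /near_x /Hr[+ _].
  by case=> ? _; apply: differentiable_continuous; exact/derivable1_diffP.
rewrite in_itv /= => /andP[xc cxh] phiE.
have [|_ phix] := Hr (x + h); first by apply: near_x; rewrite in_itv /=; lra.
have : 0 < phi' c.
  have := Hf (c - x); rewrite subr_eq0 gt_eqF// ger0_norm; last lra.
  rewrite /GRing.scale /= mulr1 subrK phi'0 subr0 => /(_ isT).
  have cf : c - x < f by lra.
  move=> /(_ cf); rewrite pmulr_rgt0// invr_gt0; lra.
move: phiE phix; rewrite addrAC subrr add0r => phiE phix c0.
have : 0 < phi' c * h by rewrite mulr_gt0.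
lra.
Qed.

End OneVariable.

(** * Restriction to lines and symmetry of second derivatives *)

Section Lines.
Context {R : realType} {V W : normedModType R}.
Implicit Types (f : V -> W) (z v : V).

Lemma is_derive_line f z v (s : R) (l : W) :
  is_derive (z + s *: v) v f l -> is_derive s 1 (fun s => f (z + s *: v)) l.
Proof.
move=> /is_deriveP fl; apply/is_deriveP; move: fl.
apply: cvg_trans; apply: near_eq_cvg; apply: nearW => h.
by rewrite [h *: 1]mulr1 scalerDl addrCA.
Qed.

Lemma cvg_line z v : z + s *: v @[s --> (0 : R)] --> z.
Proof.
rewrite -[X in _ --> X]addr0 -(scale0r v); apply: cvgD; first exact: cvg_cst.
by apply: cvgZr_tmp; exact: cvg_id.
Qed.

Lemma near_line (P : V -> Prop) z v : (\forall y \near z, P y) ->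
  \forall s \near (0 : R), P (z + s *: v).
Proof. by move=> zP; exact: (cvg_line v zP). Qed.

End Lines.

Section Schwarz.
Context {R : realType} {V : normedModType R}.
Variables (f : V -> R) (u v z : V).

(** Two applications of the mean value theorem, first in the direction [u] and
    then in the direction [v]. *)
Lemma mixed_difference (t : R) : 0 < t ->
    (forall a b, 0 <= a <= t -> 0 <= b <= t ->
      let y := z + a *: u + b *: v in
      derivable f y u /\ derivable ('D_u f) y v) ->
  exists a b, [/\ 0 < a < t, 0 < b < t &
    f (z + t *: u + t *: v) - f (z + t *: u) - f (z + t *: v) + f z =
    t ^+ 2 * 'D_v ('D_u f) (z + a *: u + b *: v)].
Proof.
move=> t0 df.
have tt : 0 <= t <= t by rewrite lexx ltW.
have t00 : 0 <= (0 : R) <= t by rewrite lexx ltW.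
pose h (a : R) := f (z + a *: u + t *: v) - f (z + a *: u).
pose h' (a : R) := 'D_u f (z + a *: u + t *: v) - 'D_u f (z + a *: u).
have dh a : 0 <= a <= t -> is_derive a 1 h (h' a).
  move=> a0t; apply: is_deriveB; last first.
    apply: is_derive_line; apply: derivableP.
    by have [+ _] := df a 0 a0t t00; rewrite scale0r addr0.
  have : is_derive a 1 (fun s : R => f ((z + t *: v) + s *: u))
     ('D_u f (z + a *: u + t *: v)).
    apply: is_derive_line; rewrite addrAC; apply: derivableP.
    by have [] := df a t a0t tt.
  by apply: is_derive_ext => s; rewrite addrAC.
have [a at0||a aI hE] := @MVT R h h' 0 t t0.
- by move: at0; rewrite in_itv /= => /andP[/ltW a0 /ltW at']; apply: dh; rewrite a0.
- apply: continuous_in_subspaceT => s; rewrite inE /= in_itv /= => /dh[? _].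
  by apply: differentiable_continuous; exact/derivable1_diffP.
have a0t : 0 <= a <= t.
  by move: aI; rewrite in_itv /= => /andP[/ltW -> /ltW ->].
pose g (b : R) := 'D_u f (z + a *: u + b *: v).
pose g' (b : R) := 'D_v ('D_u f) (z + a *: u + b *: v).
have dg b : 0 <= b <= t -> is_derive b 1 g (g' b).
  move=> b0t; apply: (@is_derive_line _ _ _ ('D_u f)); apply: derivableP.
  by have [] := df a b a0t b0t.
have [b bt0||b bI gE] := @MVT R g g' 0 t t0.
- by move: bt0; rewrite in_itv /= => /andP[/ltW b0 /ltW bt']; apply: dg; rewrite b0.
- apply: continuous_in_subspaceT => s; rewrite inE /= in_itv /= => /dg[? _].
  by apply: differentiable_continuous; exact/derivable1_diffP.
exists a, b; split; [by move: aI; rewrite in_itv|by move: bI; rewrite in_itv|].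
move: hE gE; rewrite /h /h' /g /g' !scale0r !addr0 !subr0 => + gE.
by rewrite gE expr2; lra.
Qed.
End Schwarz.

(** The second difference over a small parallelogram is symmetric in [u] and
    [v], and [mixed_difference] evaluates it both ways. *)
Lemma mixed_derivatives (R : realType) (V : normedModType R) (f : V -> R) (u v z : V) :
    (\forall y \near z, [/\ derivable f y u, derivable f y v,
       derivable ('D_u f) y v & derivable ('D_v f) y u]) ->
    {for z, continuous ('D_v ('D_u f))} -> {for z, continuous ('D_u ('D_v f))} ->
  'D_v ('D_u f) z = 'D_u ('D_v f) z.
Proof.
move=> df cvu cuv; apply/eqP; rewrite -subr_eq0; apply/eqP.
apply/eqP; rewrite -normr_le0; apply/ler_addgt0Pl => e e0; rewrite addr0.
have e2 : 0 < e / 2 by rewrite divr_gt0.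
have /cvgrPdist_lt/(_ _ e2) nvu := cvu.
have /cvgrPdist_lt/(_ _ e2) nuv := cuv.
have /nbhs_ballP[r /= r0 Hr] : \forall y \near z,
    [/\ derivable f y u, derivable f y v,
       derivable ('D_u f) y v & derivable ('D_v f) y u] /\
    (`|'D_v ('D_u f) z - 'D_v ('D_u f) y| < e / 2 /\
     `|'D_u ('D_v f) z - 'D_u ('D_v f) y| < e / 2).
  exact: (filterI df (filterI nvu nuv)).
pose t := r / (1 + `|u| + `|v|) / 2.
have uv0 : 0 < 1 + `|u| + `|v| by rewrite -addrA ltr_pwDl// addr_ge0.
have t0 : 0 < t by rewrite !divr_gt0.
have tuv : t * (`|u| + `|v|) < r.
  have : t * (1 + `|u| + `|v|) = r / 2.
    by rewrite /t mulrAC divfK // gt_eqF.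
  rewrite -addrA mulrDr mulr1 => tE; have := r0; lra.
have inball a b : 0 <= a <= t -> 0 <= b <= t -> ball z r (z + a *: u + b *: v).
  move=> /andP[a0 at'] /andP[b0 bt'].
  rewrite -ball_normE /= -addrA opprD addrA addrN add0r normrN.
  apply: le_lt_trans tuv; rewrite mulrDr; apply: le_trans (ler_normD _ _) _.
  by rewrite !normrZ !ger0_norm// lerD// ler_wpM2r.
have [|a [b [/andP[a0 at'] /andP[b0 bt'] abE]]] := @mixed_difference R V f u v z t t0.
  move=> a b a0t b0t; have [[d1 _ d3 _] _] := Hr _ (inball _ _ a0t b0t).
  exact: (conj d1 d3).
have [|a' [b' [/andP[a'0 a't] /andP[b'0 b't] abE']]] := @mixed_difference R V f v u z t t0.
  move=> a' b' a0t b0t; rewrite addrAC.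
  have [[_ d2 _ d4] _] := Hr _ (inball _ _ b0t a0t).
  exact: (conj d2 d4).
have abab : 'D_v ('D_u f) (z + a *: u + b *: v) =
            'D_u ('D_v f) (z + b' *: u + a' *: v).
  have t2 : t ^+ 2 != 0 by rewrite expf_neq0// gt_eqF.
  apply: (mulfI t2); apply: (etrans (esym abE)).
  have -> : z + b' *: u + a' *: v = z + a' *: v + b' *: u by exact: addrAC.
  apply: (etrans _ abE'); rewrite (addrAC z (t *: v)).
  by move: (f _) (f _) (f _) (f _) => p q r' s; ring.
have a0t : 0 <= a <= t by rewrite (ltW a0) ltW.
have b0t : 0 <= b <= t by rewrite (ltW b0) ltW.
have a'0t : 0 <= a' <= t by rewrite (ltW a'0) ltW.
have b'0t : 0 <= b' <= t by rewrite (ltW b'0) ltW.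
have [_ [n1 _]] := Hr _ (inball a b a0t b0t).
have [_ [_ n2]] := Hr _ (inball b' a' b'0t a'0t).
rewrite (splitr e); apply/ltW; apply: le_lt_trans (ltrD n1 n2).
rewrite abab [X in _ <= _ + X]distrC; apply: le_trans (ler_normD _ _).
by rewrite addrA subrK.
Qed.

Section Smooth.
Context {R : realType} {V : normedModType R} {m : nat}.
Variables (U : set V) (oU : open U).
Implicit Types (G : V -> 'rV[R]_m).

Lemma smooth_on_derive G (v : V) : smooth_on U G -> smooth_on U ('D_v G).
Proof. by move=> sG vs x Ux; have := sG (rcons vs v) x Ux; rewrite foldr_rcons. Qed.

Lemma smooth_on_differentiable G x : smooth_on U G -> U x -> differentiable G x.
Proof. by move=> sG; exact: (sG [::]). Qed.

Lemma is_derive_row G x v l k : is_derive x v G l ->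
  is_derive x v (fun y => G y 0 k) (l 0 k).
Proof.
move=> [dG <-]; rewrite (derive_mx dG) mxE; apply: derivableP.
exact: (derivable_mxP G x v).1.
Qed.

Lemma smooth_is_derive G x v : smooth_on U G -> U x -> is_derive x v G ('D_v G x).
Proof.
move=> sG Ux; apply: derivableP; apply: diff_derivable.
exact: smooth_on_differentiable.
Qed.

Lemma smooth_derive_row G x v k : smooth_on U G -> U x ->
  is_derive x v (fun y => G y 0 k) ('D_v G x 0 k).
Proof. by move=> sG Ux; apply: is_derive_row; exact: smooth_is_derive. Qed.

Lemma near_open x (P : V -> Prop) : U x -> (forall y, U y -> P y) ->
  \forall y \near x, P y.
Proof.
move=> Ux UP; apply: filterS (open_nbhs_nbhs (conj oU Ux)) => y; exact: UP.
Qed.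

Lemma smooth_derive2_row G x u v k : smooth_on U G -> U x ->
  is_derive x v ('D_u (fun y => G y 0 k)) ('D_v ('D_u G) x 0 k).
Proof.
move=> sG Ux; have := smooth_derive_row v k (smooth_on_derive u sG) Ux.
apply: near_eq_is_derive; apply: near_open => // y Uy.
by have /@derive_val -> := smooth_derive_row u k sG Uy.
Qed.

Lemma smooth_row_continuous G x k : smooth_on U G -> U x ->
  {for x, continuous (fun y => G y 0 k)}.
Proof.
move=> sG Ux.
apply: (@continuous_comp _ _ _ G (fun M : 'rV[R]_m => M 0 k) x).
  exact/differentiable_continuous/smooth_on_differentiable.
exact: coord_continuous.
Qed.

Lemma smooth_schwarz G x u v : smooth_on U G -> U x ->
  'D_v ('D_u G) x = 'D_u ('D_v G) x.
Proof.
move=> sG Ux; apply/rowP => k.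
pose g y := G y 0 k.
have gE u' v' y : U y -> 'D_v' ('D_u' g) y = 'D_v' ('D_u' G) y 0 k.
  by move=> Uy; have [] := smooth_derive2_row u' v' k sG Uy.
apply: (etrans (esym (gE u v x Ux))); apply: (etrans _ (gE v u x Ux)).
have cont u' v' : {for x, continuous ('D_v' ('D_u' g))}.
  have := @smooth_row_continuous _ x k (smooth_on_derive v' (smooth_on_derive u' sG)) Ux.
  rewrite /prop_for /continuous_at (gE _ _ _ Ux).
  apply: cvg_trans; apply: near_eq_cvg; apply: near_open => // y Uy.
  exact: (esym (gE _ _ _ Uy)).
apply: mixed_derivatives; [|exact: cont|exact: cont].
apply: near_open => // y Uy; split.
- by have [] := smooth_derive_row u k sG Uy.
- by have [] := smooth_derive_row v k sG Uy.
- by have [] := smooth_derive2_row u v k sG Uy.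
- by have [] := smooth_derive2_row v u k sG Uy.
Qed.

End Smooth.

(** * Derivatives of the minorant along a curve of frames *)

Section MinorantDerivative.
Context {R : realType} {m n : nat}.
Variables (Om : 'M[R]_m) (c : 'M[R]_n).
Implicit Types (E : R -> 'M[R]_(n, m)) (s : R).

Lemma mx_derive_eq p q (A : R -> 'M[R]_(p, q)) s A' B' :
  mx_derive A s A' -> A' = B' -> mx_derive A s B'.
Proof. by move=> dA <-. Qed.

Lemma mx_derive_form E (E' : R -> 'M[R]_(n, m)) s N : mx_derive E s (E' s) -> mx_derive E' s N ->
  mx_derive (fun s => (E' s)^T *m c *m E s) s
    (N^T *m c *m E s + (E' s)^T *m c *m E' s).
Proof.
move=> dE dE'.
apply: (mx_derive_eq (mx_derive_mul (mx_derive_mul (mx_derive_tr dE')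
  (mx_derive_cst c s)) dE)).
by rewrite mulmx0 addr0.
Qed.

Lemma mx_derive_form1 E s N : mx_derive E s N ->
  mx_derive (fun s => (E s)^T *m c *m E s) s
    (N^T *m c *m E s + (E s)^T *m c *m N).
Proof.
move=> dE; apply: (mx_derive_eq (mx_derive_mul (mx_derive_mul (mx_derive_tr dE)
  (mx_derive_cst c s)) dE)).
by rewrite mulmx0 addr0.
Qed.

Lemma is_derive_minorant E s N : mx_derive E s N ->
  is_derive s 1 (fun s => minorant Om c (E s)) (minorant_diff Om c (E s) N).
Proof.
move=> /mx_derive_form1 dZ.
have d1 := is_derive_mulcf 2 (is_derive_frob dZ (mx_derive_cst Om s)).
have d2 := is_derive_oppf (is_derive_frob dZ dZ).
apply: (is_derive_eq (is_derive_addf d1 d2)).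
rewrite /minorant_diff frobBr (frobC _ (N^T *m _ *m _ + _)).
by rewrite (frobC _ 0) frob0l; lra.
Qed.

Lemma is_derive_minorant_diff E (E' : R -> 'M[R]_(n, m)) s M : mx_derive E s (E' s) ->
    mx_derive E' s M ->
  is_derive s 1 (fun s => minorant_diff Om c (E s) (E' s))
    (minorant_diff2 Om c (E s) (E' s) M).
Proof.
move=> dE dE'.
have dZ := mx_derive_form1 dE.
have dl := mx_derive_form dE dE'.
have dr : mx_derive (fun s => (E s)^T *m c *m E' s) s
    ((E' s)^T *m c *m E' s + (E s)^T *m c *m M).
  apply: (mx_derive_eq (mx_derive_mul (mx_derive_mul (mx_derive_tr dE)
    (mx_derive_cst c s)) dE')).
  by rewrite mulmx0 addr0.
have dOZ := mx_derive_add (mx_derive_cst Om s) (mx_derive_opp dZ).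
apply: (is_derive_eq (is_derive_mulcf 2 (is_derive_frob (mx_derive_add dl dr) dOZ))).
rewrite /minorant_diff2 add0r frobNr; congr (2 * (frob _ _ - _)).
by rewrite scaler_nat mulr2n -!addrA.
Qed.

End MinorantDerivative.

Section Rows.
Context {R : realType} {V : normedModType R} {n m : nat}.
Variables (U : set V).

Definition rows_mx (H : 'I_n -> V -> 'rV[R]_m) (y : V) : 'M[R]_(n, m) :=
  \matrix_(a, k) H a y 0 k.

Lemma row_rows_mx H y a : row a (rows_mx H y) = H a y.
Proof. by apply/rowP => k; rewrite !mxE. Qed.

Lemma mx_derive_rows H z v s : (forall a, smooth_on U (H a)) -> U (z + s *: v) ->
  mx_derive (fun s => rows_mx H (z + s *: v)) s
    (rows_mx (fun a => 'D_v (H a)) (z + s *: v)).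
Proof.
move=> sH Us a k; rewrite mxE.
have := is_derive_line (smooth_derive_row v k (sH a) Us).
by apply: is_derive_ext => y; rewrite mxE.
Qed.

Lemma mx_derive_row (G : V -> 'rV[R]_m) z v s : smooth_on U G -> U (z + s *: v) ->
  mx_derive (fun s => G (z + s *: v)) s ('D_v G (z + s *: v)).
Proof.
move=> sG Us a k; rewrite ord1.
exact: (is_derive_line (smooth_derive_row v k sG Us)).
Qed.

End Rows.

Lemma mx_derive_unique (R : realType) p q (A : R -> 'M[R]_(p, q)) s A' B' :
  mx_derive A s A' -> mx_derive A s B' -> A' = B'.
Proof.
move=> dA dB; apply/matrixP => i j.
by have /@derive_val <- := dA i j; have /@derive_val <- := dB i j.
Qed.

Lemma mx_derive_near (R : realType) p q (A B : R -> 'M[R]_(p, q)) s A' :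
  (\forall s \near s, A s = B s) -> mx_derive A s A' -> mx_derive B s A'.
Proof.
move=> AB dA i j; apply: near_eq_is_derive (dA i j).
by apply: filterS AB => y ->.
Qed.

Lemma is_derive_linear (R : realType) (a x : R) :
  is_derive (x : R) (1 : R) (fun s : R => a * s) a.
Proof.
have did : is_derive (x : R) (1 : R) (fun s : R => s) 1 by exact: is_derive_id.
by have := is_derive_mulcf a did; rewrite mulr1.
Qed.

Lemma is_derive_expR_lin (R : realType) (a : R) :
  is_derive (0 : R) (1 : R) (fun s => expR (a * s)) a.
Proof.
have [dl le] := is_derive_linear a 0.
have de (y : R) : derivable expR y 1 by have [] := is_derive_expR y.
split.
  apply/derivable1_diffP; apply: (@differentiable_comp _ _ _ _ (fun s : R => a * s) expR).
    exact/derivable1_diffP.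
  exact/derivable1_diffP.
have dv (y : R) : 'D_1 expR y = expR y by have [] := is_derive_expR y.
have := @derive1_comp _ (fun s : R => a * s) expR 0 dl (de _).
by rewrite !derive1E le dv mulr0 expR0 mul1r.
Qed.

Lemma sum_delta (R : realType) n p (F : 'I_n -> 'I_n -> 'rV[R]_p) :
  \sum_b \sum_c (1%:M : 'M[R]_n) b c *: F b c = \sum_b F b b.
Proof.
apply: eq_bigr => b _; rewrite (bigD1 b)//= mxE eqxx scale1r big1 ?addr0//.
by move=> c cb; rewrite mxE eq_sym (negbTE cb) scale0r.
Qed.

(** * The maximum principle at a point *)

(** Space and time are not separated here: a point of [V] stands for a pair of a
    coordinate vector and a time, [e a] are the spatial directions of a frame
    which is orthonormal at [z], and [tau] is the direction of time.  Only the
    restrictions to the lines through [z] in these directions matter. *)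
Section LocalFlow.
Context {R : realType} {V : normedModType R} {n : nat}.
Local Notation m := (n + n)%N.
Variables (U : set V) (oU : open U) (G : V -> 'rV[R]_m) (sG : smooth_on U G).
Variables (z : V) (Uz : U z) (e : 'I_n -> V) (tau : V).

Definition frame_jacobian (y : V) : 'M[R]_(n, m) :=
  rows_mx (fun a => 'D_(e a) G) y.
Local Notation J := frame_jacobian.

Definition frame_hessian (a b : 'I_n) (y : V) : 'rV[R]_m :=
  'D_(e a) ('D_(e b) G) y.
Local Notation f2 := frame_hessian.

Definition frame_mean_curvature (y : V) : 'rV[R]_m :=
  \sum_a \sum_b invmx (J y *m (J y)^T) a b *:
    (f2 a b y *m (1%:M - projector (J y))).

Hypothesis flow : forall a, \forall s \near (0 : R),
  'D_tau G (z + s *: e a) = frame_mean_curvature (z + s *: e a).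
Hypothesis JJ : J z *m (J z)^T = 1%:M.

Local Notation E := (J z).
Local Notation Q := (1%:M - projector E).

(* [Gam j] holds the Christoffel symbols at [z]; [N j] and [M j] are the first
   and second derivatives, along the j-th line, of the frame (1 - s Gam j) J,
   whose covariant derivative vanishes at [z].  The vector [x] is the trace of
   the Christoffel symbols. *)
Let K j : 'M[R]_(n, m) := rows_mx (fun a => 'D_(e j) ('D_(e a) G)) z.
Let Gam j : 'M[R]_n := K j *m E^T.
Let N j : 'M[R]_(n, m) := K j *m Q.
Let L j : 'M[R]_(n, m) := rows_mx (fun a => 'D_(e j) ('D_(e j) ('D_(e a) G))) z.
Let M j : 'M[R]_(n, m) := L j - 2 *: (Gam j *m K j).
Let D : 'M[R]_(n, m) := rows_mx (fun a => 'D_tau ('D_(e a) G)) z.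
Let x : 'rV[R]_n := (\sum_b f2 b b z) *m E^T.

Let near_U v : \forall s \near (0 : R), U (z + s *: v).
Proof. by apply: near_line; exact: (near_open oU Uz (fun y Uy => Uy)). Qed.

Let sD v : smooth_on U ('D_v G). Proof. exact: smooth_on_derive. Qed.
Let sDD u v : smooth_on U ('D_u ('D_v G)).
Proof. exact: (smooth_on_derive u (smooth_on_derive v sG)). Qed.

Lemma frame_hessianC a b y : U y -> f2 a b y = f2 b a y.
Proof. by move=> Uy; exact: (smooth_schwarz oU (e b) (e a) sG Uy). Qed.

Let EQ : E *m Q = 0.
Proof. by rewrite mulmxBr mulmx1 mulmx_projector ?subrr// JJ unitmx1. Qed.

Let mean_numerator (y : V) : 'rV[R]_m :=
  \sum_b \sum_c invmx (J y *m (J y)^T) b c *: f2 b c y.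

Let frame_mean_curvatureE y : frame_mean_curvature y =
  mean_numerator y -
  mean_numerator y *m (J y)^T *m invmx (J y *m (J y)^T) *m J y.
Proof.
rewrite /frame_mean_curvature -!mulmxA -{1}(mulmx1 (mean_numerator y)) -mulmxBr.
rewrite (mulmxA (J y)^T) (_ : _ *m J y = projector (J y)); last first.
  by rewrite projector.unlock.
rewrite /mean_numerator mulmx_suml; apply: eq_bigr => b _.
by rewrite mulmx_suml; apply: eq_bigr => c _; rewrite scalemxAl.
Qed.

(** Derivative of the mean curvature vector H = h (1 - P), where h is
    [mean_numerator].  Writing h P = y J for a row y, the derivative of y only
    contributes tangentially; the derivative of the inverse metric is minus the
    symmetrized Christoffel symbols. *)
Lemma normal_velocity_derivative a :
  'D_tau ('D_(e a) G) z *m Q =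
    (\sum_b 'D_(e a) ('D_(e b) ('D_(e b) G)) z
     - 2 *: (\sum_b \sum_c Gam a b c *: f2 b c z) - x *m K a) *m Q.
Proof.
pose zl s := z + s *: e a.
have z0 : zl 0 = z by rewrite /zl scale0r addr0.
have dJ : mx_derive (fun s => J (zl s)) 0 (K a).
  have := @mx_derive_rows _ _ _ _ U (fun b => 'D_(e b) G) z (e a) 0 (fun b => sD (e b)).
  by rewrite -/(zl 0) z0; apply.
have dgram := mx_derive_mul dJ (mx_derive_tr dJ).
rewrite /= z0 (_ : E *m (K a)^T = (Gam a)^T) -/(Gam a) in dgram; last first.
  by rewrite /Gam trmx_mul trmxK.
have dginv := mx_derive_inv _ dgram; rewrite z0 in dginv.
have {}dginv := dginv JJ.
have df2 b c : mx_derive (fun s => f2 b c (zl s)) 0 ('D_(e a) (f2 b c) z).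
  have := @mx_derive_row _ _ _ U (f2 b c) z (e a) 0 (sDD _ _).
  by rewrite -/(zl 0) z0; apply.
have ginv0 : invmx (J (zl 0) *m (J (zl 0))^T) = 1%:M by rewrite z0 JJ invmx1.
have num0 : mean_numerator (zl 0) = \sum_b f2 b b z.
  by rewrite /mean_numerator ginv0 sum_delta z0.
have SS : \sum_b \sum_c (Gam a + (Gam a)^T) b c *: f2 b c z =
    2 *: (\sum_b \sum_c Gam a b c *: f2 b c z).
  rewrite scaler_nat mulr2n [X in _ = _ + X]exchange_big /= -big_split /=.
  apply: eq_bigr => b _; rewrite -big_split /=; apply: eq_bigr => c _.
  by rewrite (frame_hessianC c b Uz) -scalerDl mxE [X in _ + X]mxE.
pose num' := - (2 *: (\sum_b \sum_c Gam a b c *: f2 b c z)) +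
  \sum_b 'D_(e a) ('D_(e b) ('D_(e b) G)) z.
have dnum : mx_derive (fun s => mean_numerator (zl s)) 0 num'.
  apply: (mx_derive_eq (mx_derive_sum (fun b => mx_derive_sum (fun c =>
    mx_derive_scale (dginv b c) (df2 b c))))).
  rewrite ginv0; under eq_bigr do rewrite big_split /=.
  rewrite big_split /=; apply: f_equal2; last first.
    exact: (sum_delta (fun b c => 'D_(e a) (f2 b c) z)).
  rewrite -SS -sumrN; apply: eq_bigr => b _; rewrite -sumrN; apply: eq_bigr => c _.
  by rewrite z0 -scaleNr mxE.
have dx := mx_derive_mul (mx_derive_mul dnum (mx_derive_tr dJ)) dginv.
have dH := mx_derive_add dnum (mx_derive_opp (mx_derive_mul dx dJ)).
have dH' : mx_derive (fun s => 'D_tau G (zl s)) 0 ('D_(e a) ('D_tau G) z).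
  have := @mx_derive_row _ _ _ U ('D_tau G) z (e a) 0 (sD _).
  by rewrite -/(zl 0) z0; apply.
have {}dH' : mx_derive (fun s => frame_mean_curvature (zl s)) 0
    ('D_(e a) ('D_tau G) z) by exact: mx_derive_near (flow a) dH'.
have {}dH' := mx_derive_ext (fun s => frame_mean_curvatureE (zl s)) dH'.
have -> : 'D_tau ('D_(e a) G) z = 'D_(e a) ('D_tau G) z.
  exact: (smooth_schwarz oU (e a) tau sG Uz).
rewrite (mx_derive_unique dH' dH).
rewrite ginv0 num0 !mulmx1 z0 -/x; set x' := (X in _ - (X *m E + _)).
rewrite [LHS]mulmxBl [X in _ - X]mulmxDl -(mulmxA x') EQ mulmx0 add0r.
by rewrite [RHS]mulmxBl; congr (_ *m _ - _); exact: addrC.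
Qed.

(** Codazzi: by the symmetry of third derivatives the Laplacian of the frame is
    the derivative of the Laplacian of the immersion, and the Christoffel terms
    produced by the inverse metric cancel those of the moving frame. *)
Lemma normal_evolution :
  (D - \sum_j M j + \sum_j x 0 j *: N j) *m Q = 0.
Proof.
have Eu : E *m E^T \in unitmx by rewrite JJ unitmx1.
have QQ : Q *m Q = Q.
  by rewrite mulmxBr mulmx1 mulmxBl mul1mx (projector_idem Eu) subrr subr0.
have rowK j a : row a (K j) = f2 j a z by rewrite row_rows_mx.
apply/row_matrixP => a; rewrite row0 row_mul.
have -> : row a (D - \sum_j M j + \sum_j x 0 j *: N j) =
    row a D - \sum_j row a (M j) + \sum_j row a (x 0 j *: N j).
  by rewrite raddfD raddfB /= !raddf_sum.
have rowM j : row a (M j) = 'D_(e a) ('D_(e j) ('D_(e j) G)) z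
    - 2 *: \sum_c Gam a j c *: f2 j c z.
  rewrite /M linearB /= linearZ /= row_rows_mx; apply: f_equal2; last first.
    apply: f_equal; apply: f_equal; rewrite row_mul mulmx_sum_row.
    apply: eq_bigr => c _; rewrite rowK; apply: f_equal2 => //.
    have -> : Gam a j c = row j (Gam a) 0 c by rewrite [RHS]mxE.
    by rewrite !row_mul !rowK (frame_hessianC j a Uz).
  have swap : forall y, U y ->
      'D_(e j) ('D_(e a) G) y = 'D_(e a) ('D_(e j) G) y.
    by move=> y Uy; exact: (smooth_schwarz oU (e a) (e j) sG Uy).
  apply: (etrans _ (esym (smooth_schwarz oU (e j) (e a) (sD (e j)) Uz))).
  by apply: near_eq_derive; exact: (near_open oU Uz swap).
have rowN j : row a (x 0 j *: N j) = (x 0 j *: f2 a j z) *m Q.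
  by rewrite linearZ /= row_mul rowK -scalemxAl (frame_hessianC j a Uz).
rewrite row_rows_mx (eq_bigr _ (fun j _ => rowM j)) (eq_bigr _ (fun j _ => rowN j)).
rewrite mulmxDl mulmxBl normal_velocity_derivative -mulmx_suml -(mulmxA _ Q) QQ.
rewrite -mulmxBl -mulmxDl; set S := (X in X *m Q); suff -> : S = 0 by rewrite mul0mx.
rewrite /S sumrB -scaler_sumr.
have -> : x *m K a = \sum_j x 0 j *: f2 a j z.
  by rewrite mulmx_sum_row; apply: eq_bigr => j _; rewrite rowK.
set X := (X in X - _ - _ + _).
by rewrite -/X (addrAC X) subrr add0r addNr.
Qed.

Variables (Om : 'M[R]_m) (Omu : Om *m Om^T = 1%:M) (Oma : Om^T = - Om).
Variables (B h0 eps : R) (h0_gt0 : 0 < h0) (eps_gt0 : 0 < eps).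
Hypothesis flow0 : 'D_tau G z = frame_mean_curvature z.
Hypothesis curvature : \sum_a \sum_b frob (f2 a b z *m Q) (f2 a b z *m Q) <= B.
Hypothesis space_unit : forall j, \forall s \near (0 : R),
  J (z + s *: e j) *m (J (z + s *: e j))^T \in unitmx.
Hypothesis space_max : forall j, \forall s \near (0 : R),
  h0 * defect Om (J (z + s *: e j)) - eps * frob (G (z + s *: e j)) (G (z + s *: e j))
  <= h0 * defect Om E - eps * frob (G z) (G z).
Hypothesis time_unit : \forall s \near (0 : R), s <= 0 ->
  J (z + s *: tau) *m (J (z + s *: tau))^T \in unitmx.
Hypothesis time_max : \forall s \near (0 : R), s <= 0 ->
  expR (- (8 * B) * s) * (h0 * defect Om (J (z + s *: tau)))
  - eps * (frob (G (z + s *: tau)) (G (z + s *: tau)) + (2 * n%:R + 1) * s)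
  <= h0 * defect Om E - eps * frob (G z) (G z).

Let c : 'M[R]_n := E *m Om *m E^T.

Let NE j : N j *m E^T = 0.
Proof.
have QE : Q *m E^T = 0.
  by apply: trmx_inj; rewrite trmx_mul trmxK linearB /= trmx1 projector_sym EQ trmx0.
by rewrite /N -mulmxA QE mulmx0.
Qed.

Let NB : \sum_j frob (N j) (N j) <= B.
Proof.
apply: le_trans curvature; rewrite le_eqVlt; apply/orP; left; apply/eqP.
apply: eq_bigr => j _; rewrite frobE; apply: eq_bigr => a _.
rewrite frobE big_ord1; apply: eq_bigr => k _.
have -> : N j a k = row a (N j) 0 k by rewrite [RHS]mxE.
by rewrite /N row_mul row_rows_mx.
Qed.

(* Along the j-th line the barrier is replaced by its polynomial minorant, which
   has the same value at [z] and hence also a maximum there. *)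
Let space_derivative j :
  h0 * minorant_diff Om c E (N j) - eps * (2 * frob ('D_(e j) G z) (G z)) = 0 /\
  h0 * minorant_diff2 Om c E (N j) (M j) - eps * (2 * (frob (f2 j j z) (G z) +
    frob ('D_(e j) G z) ('D_(e j) G z))) <= 0.
Proof.
pose zl s := z + s *: e j.
have z0 : zl 0 = z by rewrite /zl scale0r addr0.
pose Ky y : 'M[R]_(n, m) := rows_mx (fun a => 'D_(e j) ('D_(e a) G)) y.
pose A s : 'M[R]_n := 1%:M - s *: Gam j.
have dA s : mx_derive A s (- Gam j).
  have d1 : mx_derive (fun s : R => s *: Gam j) s (Gam j).
    have did : is_derive (s : R) (1 : R) (fun s : R => s) 1 by exact: is_derive_id.
    apply: (mx_derive_eq (mx_derive_scale did (mx_derive_cst (Gam j) s))).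
    by rewrite scale1r scaler0 addr0.
  apply: (mx_derive_eq (mx_derive_add (mx_derive_cst 1%:M s) (mx_derive_opp d1))).
  by rewrite add0r.
have dJ s : U (zl s) -> mx_derive (fun s => J (zl s)) s (Ky (zl s)).
  exact: (@mx_derive_rows _ _ _ _ U (fun b => 'D_(e b) G) z (e j) s (fun b => sD (e b))).
have dK : mx_derive (fun s => Ky (zl s)) 0 (L j).
  have := @mx_derive_rows _ _ _ _ U (fun b => 'D_(e j) ('D_(e b) G)) z (e j) 0
    (fun b => sDD (e j) (e b)).
  by rewrite -/(zl 0) z0; apply.
pose El s := A s *m J (zl s).
pose El' s := - Gam j *m J (zl s) + A s *m Ky (zl s).
have dE s : U (zl s) -> mx_derive El s (El' s).
  by move=> Us; exact: mx_derive_mul (dA s) (dJ s Us).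
have A0 : A 0 = 1%:M by rewrite /A scale0r subr0.
have E0 : El 0 = E by rewrite /El A0 mul1mx z0.
have E'0 : El' 0 = N j.
  rewrite /El' A0 mul1mx z0 /N mulmxBr mulmx1 (projector_orthonormal JJ) mulmxA.
  by rewrite mulNmx addrC.
have Uz0 : U (zl 0) by rewrite z0.
have dE' : mx_derive El' 0 (M j).
  have d := mx_derive_add (mx_derive_mul (mx_derive_cst (- Gam j) 0) (dJ 0 Uz0))
    (mx_derive_mul (dA 0) dK).
  apply: (mx_derive_eq d); rewrite mul0mx add0r A0 mul1mx z0 /M.
  have -> : - Gam j *m Ky z = - (Gam j *m K j) by exact: mulNmx.
  by rewrite scaler_nat mulr2n opprD addrA addrC.
pose dG := @mx_derive_row _ _ _ U G z (e j).
pose phi s := h0 * minorant Om c (El s) + - (eps * frob (G (zl s)) (G (zl s))).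
pose phi' s := h0 * minorant_diff Om c (El s) (El' s) +
  - (eps * (2 * frob ('D_(e j) G (zl s)) (G (zl s)))).
have dphi s : U (zl s) -> is_derive s 1 phi (phi' s).
  move=> Us; apply: is_derive_addf.
    exact/is_derive_mulcf/is_derive_minorant/dE.
  apply: is_derive_oppf; apply: is_derive_mulcf.
  apply: (is_derive_eq (is_derive_frob (dG s sG Us) (dG s sG Us))).
  by rewrite (frobC (G _)) -mulr2n mulr_natl.
have dphi' : is_derive (0 : R) (1 : R) phi' (h0 * minorant_diff2 Om c (El 0) (El' 0) (M j) +
    - (eps * (2 * (frob (f2 j j (zl 0)) (G (zl 0)) +
        frob ('D_(e j) G (zl 0)) ('D_(e j) G (zl 0)))))).
  apply: is_derive_addf.
    exact/is_derive_mulcf/(is_derive_minorant_diff _ _ (dE 0 Uz0) dE').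
  apply: is_derive_oppf; apply: is_derive_mulcf; apply: is_derive_mulcf.
  apply: is_derive_frob (dG 0 sG Uz0).
  exact: (@mx_derive_row _ _ _ U ('D_(e j) G) z (e j) 0 (sD _) Uz0).
have near_dphi : \forall s \near (0 : R), is_derive (s : R) (1 : R) phi (phi' s).
  by apply: filterS (near_U (e j)) => s; exact: dphi.
have phi_max : \forall s \near (0 : R), phi s <= phi 0.
  near=> s; rewrite /phi E0 z0 (minorant_eq Om JJ).
  apply: le_trans (_ : h0 * defect Om (J (zl s)) - eps * frob (G (zl s)) (G (zl s)) <= _).
    rewrite lerD2r; apply: ler_wpM2l; first exact: ltW.
    apply: minorant_le; near: s; exact: space_unit.
  by near: s; exact: space_max.
have [] := second_derivative_max near_dphi dphi' phi_max.
by rewrite /phi' E0 E'0 z0.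
Unshelve. all: by end_near. Qed.

Let time_derivative :
  0 <= - (8 * B) * (h0 * defect Om E) + h0 * minorant_diff Om c E D
    - eps * (2 * frob ('D_tau G z) (G z) + (2 * n%:R + 1)).
Proof.
pose zl s := z + s *: tau.
have z0 : zl 0 = z by rewrite /zl scale0r addr0.
have dJ : mx_derive (fun s => J (zl s)) 0 D.
  have := @mx_derive_rows _ _ _ _ U (fun b => 'D_(e b) G) z tau 0 (fun b => sD (e b)).
  by rewrite -/(zl 0) z0; apply.
have dG : mx_derive (fun s => G (zl s)) 0 ('D_tau G z).
  by have := @mx_derive_row _ _ _ U G z tau 0 sG; rewrite -/(zl 0) z0; apply.
pose phi s := expR (- (8 * B) * s) * (h0 * minorant Om c (J (zl s))) +
   - (eps * (frob (G (zl s)) (G (zl s)) + (2 * n%:R + 1) * s)).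
have dexp : is_derive (0 : R) (1 : R) (fun s => expR (- (8 * B) * s)) (- (8 * B)).
  exact: is_derive_expR_lin.
have dphi : is_derive (0 : R) (1 : R) phi (
    (- (8 * B) * (h0 * minorant Om c (J (zl 0))) +
     expR (- (8 * B) * 0) * (h0 * minorant_diff Om c (J (zl 0)) D)) +
    - (eps * ((frob ('D_tau G z) (G (zl 0)) + frob (G (zl 0)) ('D_tau G z)) +
        (2 * n%:R + 1)))).
  apply: is_derive_addf.
    apply: (is_derive_mulf dexp).
    exact/is_derive_mulcf/is_derive_minorant/dJ.
  apply: is_derive_oppf; apply: is_derive_mulcf; apply: is_derive_addf.
    exact: is_derive_frob.
  exact: is_derive_linear.
have phi_max : \forall s \near (0 : R), s <= 0 -> phi s <= phi 0.
  near=> s => s0; rewrite [leRHS]/phi z0 !mulr0 expR0 mul1r addr0 (minorant_eq Om JJ).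
  apply: le_trans (_ : expR (- (8 * B) * s) * (h0 * defect Om (J (zl s))) -
    eps * (frob (G (zl s)) (G (zl s)) + (2 * n%:R + 1) * s) <= _).
    rewrite lerD2r; apply: ler_wpM2l; first exact: expR_ge0.
    apply: ler_wpM2l; first exact: ltW.
    rewrite -[X in minorant _ _ X]mul1mx; apply: minorant_le.
    by move: s0; near: s; exact: time_unit.
  by move: s0; near: s; exact: time_max.
have := left_max_derive dphi phi_max.
rewrite z0 (minorant_eq Om JJ) mulr0 expR0 mul1r (frobC (G z)).
by rewrite (_ : forall y : R, y + y = 2 * y)//; move=> y; ring.
Unshelve. all: by end_near. Qed.

(** The first- and second-order conditions at the maximum are combined into the
    heat operator d/dt - Delta.  The defect contributes at most 0 after the
    exponential weight is taken into account, and - eps |G|^2 - eps (2 n + 1) t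
    contributes - eps, as (d/dt - Delta) |G|^2 = - 2 n. *)
Lemma no_interior_maximum : False.
Proof.
have dE : defect Om E = frob c c by rewrite (defect_orthonormal _ JJ).
have ev := minorant_evolution Omu Oma JJ (erefl : c = _) NE normal_evolution NB.
have hD : 'D_tau G z = \sum_j f2 j j z - \sum_j x 0 j *: 'D_(e j) G z.
  rewrite flow0 frame_mean_curvatureE JJ invmx1 mulmx1.
  have -> : mean_numerator z = \sum_j f2 j j z.
    by rewrite /mean_numerator JJ invmx1 sum_delta.
  rewrite -/x mulmx_sum_row; congr (_ - _); apply: eq_bigr => j _.
  by rewrite row_rows_mx.
have hG : frob ('D_tau G z) (G z) = \sum_j frob (f2 j j z) (G z)
   - \sum_j x 0 j * frob ('D_(e j) G z) (G z).
  by rewrite hD frobBl !frob_suml; congr (_ - _); apply: eq_bigr => j _; rewrite frobZl.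
have hE : \sum_j frob ('D_(e j) G z) ('D_(e j) G z) = n%:R.
  have <- : frob E E = n%:R by rewrite /frob JJ mxtrace1.
  rewrite [RHS]frobE; apply: eq_bigr => j _; rewrite frobE big_ord1.
  by apply: eq_bigr => k _; rewrite !mxE.
have s1 : \sum_j x 0 j * (h0 * minorant_diff Om c E (N j)
    - eps * (2 * frob ('D_(e j) G z) (G z))) = 0.
  by apply: big1 => j _; have [-> _] := space_derivative j; rewrite mulr0.
have s2 : \sum_j (h0 * minorant_diff2 Om c E (N j) (M j) - eps * (2 * (frob (f2 j j z) (G z) +
    frob ('D_(e j) G z) ('D_(e j) G z)))) <= 0.
  by apply: sumr_le0 => j _; have [] := space_derivative j.
have s1E : h0 * (\sum_j x 0 j * minorant_diff Om c E (N j))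
    - eps * (2 * \sum_j x 0 j * frob ('D_(e j) G z) (G z)) = 0.
  apply: etrans s1; rewrite !mulr_sumr -sumrB; apply: eq_bigr => j _; ring.
have s2E : h0 * (\sum_j minorant_diff2 Om c E (N j) (M j))
    - eps * (2 * (\sum_j frob (f2 j j z) (G z) + n%:R)) <= 0.
  apply: le_trans s2; rewrite -hE -big_split /= !mulr_sumr -sumrB.
  by apply: ler_sum => j _.
have := time_derivative; rewrite dE hG.
move: ev s1E s2E; set md := minorant_diff _ _ _ D; set S1 := \sum_j x 0 j * minorant_diff _ _ _ _.
set S2 := \sum_j minorant_diff2 _ _ _ _ _; set S3 := \sum_j frob (f2 j j z) _.
set S4 := \sum_j x 0 j * frob _ _ => ev s1E s2E tE.
have ev' : h0 * (md - S2 + S1) <= h0 * (8 * B * frob c c).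
  by apply: ler_wpM2l => //; exact: ltW.
have := eps_gt0.
nra.
Qed.

End LocalFlow.

(** * Mean curvature and second fundamental form in a frame *)

Lemma normal_partE (R : realType) n m (f : 'rV[R]_n -> 'rV[R]_m) p w :
  row_free (jacobian f p) ->
  normal_part f p w = w *m (1%:M - projector (jacobian f p)).
Proof.
move=> Jf; rewrite /normal_part; set J := jacobian f p in Jf *.
have Ju := gram_unit Jf.
pose v := w *m (1%:M - projector J).
have vK : (v <= kermx J^T)%MS.
  have PJT : projector J *m J^T = J^T.
    by apply: trmx_inj; rewrite trmx_mul trmxK projector_sym mulmx_projector.
  by apply/sub_kermxP; rewrite /v -mulmxA mulmxBl mul1mx PJT subrr mulmx0.
have wJ : (w *m projector J <= <<J>>)%MS.
  by rewrite genmxE projector.unlock mulmxA submxMl.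
have cap : (kermx J^T :&: <<J>>)%MS = 0.
  apply/eqP; rewrite -submx0; apply/rV_subP => u.
  rewrite sub_capmx genmxE => /andP[/sub_kermxP uJ /submxP[x ux]].
  rewrite submx0; apply/eqP; apply: frob_eq0.
  by rewrite /frob {2}ux trmx_mul mulmxA uJ mul0mx mxtrace0.
have wE : w = v + w *m projector J by rewrite /v mulmxBr mulmx1 subrK.
by rewrite {1}wE mulmxDl (proj_mx_id cap vK) (proj_mx_0 cap wJ) addr0.
Qed.

Lemma jacobianE (R : realType) n m (f : 'rV[R]_n -> 'rV[R]_m) p v :
  'd f p v = v *m jacobian f p.
Proof. by rewrite /jacobian mul_rV_lin1. Qed.

Lemma injective_row_free (R : realType) n m (f : 'rV[R]_n -> 'rV[R]_m) p :
  injective ('d f p) -> row_free (jacobian f p).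
Proof.
move=> inj; rewrite -kermx_eq0; apply/eqP/row_matrixP => i; rewrite row0.
apply: inj; rewrite !jacobianE mul0mx -row_mul mulmx_ker row0 //.
Qed.

Lemma exchange_big4 (V : nmodType) (I J K L : finType) (F : I -> J -> K -> L -> V) :
  \sum_a \sum_b \sum_i \sum_j F a b i j = \sum_i \sum_j \sum_a \sum_b F a b i j.
Proof.
under eq_bigr => a _ do rewrite exchange_big /=.
rewrite exchange_big /=; apply: eq_bigr => i _.
under eq_bigr => a _ do rewrite exchange_big /=.
by rewrite exchange_big.
Qed.

Section Frames.
Context {R : realType} {n m : nat}.
Variables (U : set 'rV[R]_n) (oU : open U) (f : 'rV[R]_n -> 'rV[R]_m).
Hypothesis sf : smooth_on U f.
Variables (q : 'rV[R]_n) (Uq : U q) (A : 'M[R]_n).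
Local Notation J := (jacobian f q).

Definition frame_rows : 'M[R]_(n, m) := rows_mx (fun a => 'D_(row a A) f) q.

Lemma frame_rowsE : frame_rows = A *m J.
Proof.
apply/row_matrixP => a; rewrite row_rows_mx row_mul.
by apply: deriveEjacobian; exact: smooth_on_differentiable sf Uq.
Qed.

Definition coord_hessian (i j : 'I_n) : 'rV[R]_m :=
  'D_(delta_mx 0 i) ('D_(delta_mx 0 j) f) q.

Lemma flat_connection_coord i j :
  flat_connection f (coord_field i) (coord_field j) q = coord_hessian i j.
Proof.
rewrite /flat_connection /coord_field /=; apply: near_eq_derive.
apply: (near_open oU Uq) => y Uy; apply/esym; apply: deriveE.
exact: smooth_on_differentiable sf Uy.
Qed.

Lemma derive_coords (g : 'rV[R]_n -> 'rV[R]_m) y (v : 'rV[R]_n) : differentiable g y ->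
  'D_v g y = \sum_i v 0 i *: 'D_(delta_mx 0 i) g y.
Proof.
move=> dg; rewrite (deriveEjacobian _ dg) mulmx_sum_row; apply: eq_bigr => i _.
by rewrite (deriveEjacobian _ dg) rowE.
Qed.

Lemma frame_hessianE a b : 'D_(row a A) ('D_(row b A) f) q =
  \sum_i \sum_j (A a i * A b j) *: coord_hessian i j.
Proof.
rewrite derive_coords; last first.
  exact: smooth_on_differentiable (smooth_on_derive _ sf) Uq.
apply: eq_bigr => i _; rewrite mxE.
under eq_bigr do rewrite -scalerA; rewrite -scaler_sumr; congr (_ *: _).
have -> : 'D_(delta_mx 0 i) ('D_(row b A) f) q =
    'D_(delta_mx 0 i) (\sum_j (A b j *: 'D_(delta_mx 0 j) f)) q.
  apply: near_eq_derive; apply: (near_open oU Uq) => y Uy.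
  rewrite derive_coords; last exact: smooth_on_differentiable sf Uy.
  by rewrite fct_sumE; apply: eq_bigr => j _; rewrite mxE.
rewrite derive_sum => [|j].
  apply: eq_bigr => j _; rewrite deriveZ//.
  by have [] := smooth_is_derive (delta_mx 0 i) (smooth_on_derive (delta_mx 0 j) sf) Uq.
apply: derivableZ.
by have [] := smooth_is_derive (delta_mx 0 i) (smooth_on_derive (delta_mx 0 j) sf) Uq.
Qed.

Hypotheses (Au : A \in unitmx) (Jf : row_free J).
Local Notation Q := (1%:M - projector J).

Lemma sff_coefE i j : sff_coef f q i j = coord_hessian i j *m Q.
Proof.
by rewrite /sff_coef /second_fundamental_form normal_partE// flat_connection_coord.
Qed.

(** The trace with respect to the metric does not depend on the frame. *)
Lemma mean_curvature_frame : mean_curvature f q =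
  \sum_a \sum_b invmx (frame_rows *m frame_rows^T) a b *:
    ('D_(row a A) ('D_(row b A) f) q *m (1%:M - projector frame_rows)).
Proof.
rewrite frame_rowsE (projector_mul (gram_unit Jf) Au) trmx_mul.
rewrite /mean_curvature /induced_metric.
have -> : A *m J *m (J^T *m A^T) = A *m (J *m J^T) *m A^T by rewrite !mulmxA.
rewrite -(invmx_congr (gram_unit Jf) Au); set X := invmx (A *m _ *m _).
have -> : \sum_a \sum_b X a b *: ('D_(row a A) ('D_(row b A) f) q *m Q) =
  \sum_a \sum_b \sum_i \sum_j (X a b * (A a i * A b j)) *: sff_coef f q i j.
  apply: eq_bigr => a _; apply: eq_bigr => b _; rewrite frame_hessianE.
  rewrite mulmx_suml scaler_sumr; apply: eq_bigr => i _.
  rewrite mulmx_suml scaler_sumr; apply: eq_bigr => j _.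
  by rewrite -scalemxAl scalerA sff_coefE.
have -> : \sum_a \sum_b \sum_i \sum_j (X a b * (A a i * A b j)) *: sff_coef f q i j =
   \sum_i \sum_j \sum_a \sum_b (X a b * (A a i * A b j)) *: sff_coef f q i j.
  exact: exchange_big4.
apply: eq_bigr => i _; apply: eq_bigr => j _.
rewrite mxE scaler_suml exchange_big /=; apply: eq_bigr => b _.
rewrite mxE mulr_suml scaler_suml; apply: eq_bigr => a _.
by rewrite mxE; congr (_ *: _); ring.
Qed.

(** For an orthonormal frame the inverse metric is A^T A, so the contraction in
    [sff_norm] is a sum of squares. *)
Lemma sff_frame (C0 : R) : frame_rows *m frame_rows^T = 1%:M -> sff_norm f q <= C0 ->
  \sum_a \sum_b frob ('D_(row a A) ('D_(row b A) f) q *m Q)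
                     ('D_(row a A) ('D_(row b A) f) q *m Q) <= C0 ^+ 2.
Proof.
move=> JJ; rewrite /sff_norm /induced_metric.
have ginvE : invmx (J *m J^T) = A^T *m A.
  rewrite -(invmx_congr (gram_unit Jf) Au).
  have -> : A *m (J *m J^T) *m A^T = frame_rows *m frame_rows^T.
    by rewrite frame_rowsE trmx_mul !mulmxA.
  by rewrite JJ invmx1 mulmx1.
(* each ambient coordinate gives an n x n matrix, and conjugation by [A] turns
   it into the matrix in the frame *)
pose S k : 'M[R]_n := \matrix_(i, j) sff_coef f q i j 0 k.
have -> : \sum_i \sum_j \sum_k \sum_l invmx (J *m J^T) i k * invmx (J *m J^T) j l *
    dotv (sff_coef f q i j) (sff_coef f q k l) =
   \sum_k frob (A *m S k *m A^T) (A *m S k *m A^T).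
  have step k : frob (A *m S k *m A^T) (A *m S k *m A^T) =
     frob (S k) ((A^T *m A) *m S k *m (A^T *m A)^T).
    by rewrite frob_mulmr frob_mulml trmxK trmx_mul trmxK !mulmxA.
  under [RHS]eq_bigr do rewrite step -ginvE frobE.
  rewrite [RHS]exchange_big /=; apply: eq_bigr => i _.
  rewrite [RHS]exchange_big /=; apply: eq_bigr => j _.
  set g := invmx _.
  have dE k l : g i k * g j l * dotv (sff_coef f q i j) (sff_coef f q k l) =
     \sum_r S r i j * (g i k * S r k l * g j l).
    rewrite /dotv mxE mulr_sumr; apply: eq_bigr => r _; rewrite !mxE; ring.
  under eq_bigr => k _ do under eq_bigr => l _ do rewrite dE.
  under eq_bigr => k _ do rewrite exchange_big /=.
  rewrite exchange_big /=; apply: eq_bigr => r _.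
  rewrite !mxE mulr_sumr exchange_big /=; apply: eq_bigr => l _.
  by rewrite mxE [X in _ = _ * (_ * X)]mxE mulr_suml mulr_sumr.
have -> : \sum_a \sum_b frob ('D_(row a A) ('D_(row b A) f) q *m Q)
                     ('D_(row a A) ('D_(row b A) f) q *m Q) =
   \sum_k frob (A *m S k *m A^T) (A *m S k *m A^T).
  under [RHS]eq_bigr do rewrite frobE.
  rewrite [RHS]exchange_big /=; apply: eq_bigr => a _.
  rewrite [RHS]exchange_big /=; apply: eq_bigr => b _.
  rewrite frobE big_ord1; apply: eq_bigr => r _.
  suff -> : (A *m S r *m A^T) a b = ('D_(row a A) ('D_(row b A) f) q *m Q) 0 r by [].
  rewrite frame_hessianE mxE; under eq_bigr do rewrite mxE mulr_suml.
  rewrite exchange_big mulmx_suml summxE; apply: eq_bigr => i _.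
  rewrite mulmx_suml summxE; apply: eq_bigr => j _.
  by rewrite -scalemxAl -sff_coefE !mxE; ring.
move=> sC.
have s0 : 0 <= \sum_k frob (A *m S k *m A^T) (A *m S k *m A^T).
  by apply: sumr_ge0 => k _; exact: frob_ge0.
have C00 : 0 <= C0 := le_trans (sqrtr_ge0 _) sC.
by rewrite -(sqr_sqrtr s0) ler_sqr ?nnegrE ?sqrtr_ge0.
Qed.

End Frames.

Lemma diagonal_le_sum (R : realType) n (F : 'I_n -> 'I_n -> R) a :
  (forall b c, 0 <= F b c) -> F a a <= \sum_b \sum_c F b c.
Proof.
move=> F0; rewrite (bigD1 a)//= (bigD1 a)//= -addrA lerDl addr_ge0//.
  by apply: sumr_ge0 => b _.
by apply: sumr_ge0 => b _; apply: sumr_ge0.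
Qed.

Section CurvatureBound.
Context {R : realType} {n m : nat}.
Variables (U : set 'rV[R]_n) (oU : open U) (f : 'rV[R]_n -> 'rV[R]_m).
Hypothesis sf : smooth_on U f.
Variables (q : 'rV[R]_n) (Uq : U q).

Lemma mean_curvature_bound (C0 : R) k : row_free (jacobian f q) ->
  sff_norm f q <= C0 -> `|mean_curvature f q 0 k| <= n%:R * C0.
Proof.
move=> Jf sC; have [A Au AJ] := orthonormal_frame Jf.
have C00 : 0 <= C0 := le_trans (sqrtr_ge0 _) sC.
have fr : frame_rows f q A = A *m jacobian f q by exact: (frame_rowsE sf Uq).
have JJ : frame_rows f q A *m (frame_rows f q A)^T = 1%:M by rewrite fr.
have := sff_frame oU sf Uq Au Jf JJ sC => sums.
rewrite (mean_curvature_frame oU sf Uq Au Jf) JJ invmx1 fr.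
rewrite (projector_mul (gram_unit Jf) Au) sum_delta summxE.
have -> : n%:R * C0 = \sum_(a < n) C0 by rewrite sumr_const card_ord mulr_natl.
apply: le_trans (ler_norm_sum _ _ _) _; apply: ler_sum => a _.
rewrite -ler_sqr ?nnegrE// real_normK ?num_real//.
apply: le_trans (frob_entry_le _ _ _) _.
pose S a b := frob ('D_(row a A) ('D_(row b A) f) q *m (1%:M - projector (jacobian f q)))
  ('D_(row a A) ('D_(row b A) f) q *m (1%:M - projector (jacobian f q))).
exact: (le_trans (@diagonal_le_sum _ _ S a (fun _ _ => frob_ge0 _)) sums).
Qed.

End CurvatureBound.

(** * The symplectic form and Lagrangian immersions *)

Section SymplecticMatrix.
Context {R : realType} {n : nat}.

Definition symplectic_mx : 'M[R]_(n + n) := block_mx 0 1%:M (- 1%:M) 0.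

Lemma symplectic_formE (u v : 'rV[R]_(n + n)) :
  symplectic_form u v = (u *m symplectic_mx *m v^T) 0 0.
Proof.
rewrite /symplectic_form /dotv -{3}(hsubmxK u) -{3}(hsubmxK v) /symplectic_mx.
rewrite mul_row_block !mulmx0 mulmx1 add0r addr0 mulmxN mulmx1 tr_row_mx mul_row_col.
by rewrite mulNmx [RHS]mxE [X in _ = X + _]mxE addrC.
Qed.

Lemma symplectic_mx_orthogonal : symplectic_mx *m symplectic_mx^T = 1%:M.
Proof.
rewrite /symplectic_mx tr_block_mx !trmx0 linearN /= trmx1 mulmx_block.
rewrite !mul0mx !mulmx0 !mulmx1 mulNmx mulmxN mulmx1 opprK !addr0 !add0r.
by rewrite -scalar_mx_block.
Qed.

Lemma symplectic_mx_skew : symplectic_mx^T = - symplectic_mx.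
Proof.
by rewrite /symplectic_mx tr_block_mx !trmx0 linearN /= trmx1 opp_block_mx !oppr0 opprK.
Qed.

End SymplecticMatrix.
Arguments symplectic_mx {R} n.

Section Charts.
Context {R : realType} {n : nat} {M : smooth_manifold R n}.
Implicit Types (c d : chart R n M) (x y : M).

Lemma chart_invK c x : chart_dom c x -> chart_inv c (c x) = x.
Proof. by move=> cx; apply: (@chart_mapK _ _ _ c); exact: mem_set. Qed.

Lemma chart_img_map c x : chart_dom c x -> chart_img c (c x).
Proof. by move=> cx; exists x. Qed.

Lemma chart_img_inv c q : chart_img c q -> chart_dom c (chart_inv c q).
Proof. by move=> [x cx <-]; rewrite chart_invK. Qed.

Lemma chart_map_inv c q : chart_img c q -> c (chart_inv c q) = q.
Proof. by move=> [x cx <-]; rewrite chart_invK. Qed.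

Lemma open_chart_img c : open (chart_img c).
Proof. exact: chart_img_open. Qed.

Lemma chart_map_cvg c x : chart_dom c x -> c y @[y --> x] --> c x.
Proof.
move=> cx; have := @chart_map_continuous _ _ _ c.
rewrite (continuous_open_subspace _ (chart_dom_open c)) => /(_ x).
by rewrite inE; apply.
Qed.

Lemma chart_inv_cvg c x : chart_dom c x -> chart_inv c q @[q --> c x] --> x.
Proof.
move=> cx; have := @chart_inv_continuous _ _ _ c.
rewrite (continuous_open_subspace _ (@chart_img_open _ _ _ c)) => /(_ (c x)).
rewrite inE /continuous_at chart_invK//; apply; exact: chart_img_map.
Qed.

Lemma near_chart_dom c x : chart_dom c x -> \forall y \near x, chart_dom c y.
Proof. by move=> cx; exact: open_nbhs_nbhs (conj (chart_dom_open c) cx). Qed.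

Lemma near_chart_img c q : chart_img c q -> \forall y \near q, chart_img c y.
Proof. by move=> cx; exact: open_nbhs_nbhs (conj (@open_chart_img c) cx). Qed.

(** Chain rule: near the point, the expression in [c] is the expression in [d]
    composed with the transition map. *)
Lemma jacobian_chart_change m (f : M -> 'rV[R]_m) c d x :
    atlas c -> atlas d -> chart_dom c x -> chart_dom d x ->
    differentiable (in_chart f c) (c x) -> differentiable (in_chart f d) (d x) ->
  exists B : 'M[R]_n,
    jacobian (in_chart f c) (c x) = B *m jacobian (in_chart f d) (d x).
Proof.
move=> ac ad cx dx dfc dfd.
have tr := @atlas_compatible _ _ M c d ac ad [::] (c x).
have {}tr : differentiable (d \o chart_inv c) (c x) by apply: tr; exists x.
exists (jacobian (d \o chart_inv c) (c x)); apply/row_matrixP => i.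
rewrite row_mul !rowE -(deriveEjacobian _ dfc) -(deriveEjacobian _ tr).
have near_eq : \forall q \near c x,
    in_chart f c q = (in_chart f d \o (d \o chart_inv c)) q.
  have nd : \forall q \near c x, chart_dom d (chart_inv c q).
    exact: (chart_inv_cvg cx (near_chart_dom dx)).
  apply: filterS nd => q dq.
  by rewrite /in_chart /= chart_invK.
rewrite (near_eq_derive _ near_eq).
have dfd' : differentiable (in_chart f d) ((d \o chart_inv c) (c x)).
  by rewrite /= chart_invK.
rewrite deriveE; last exact: differentiable_comp.
rewrite diff_comp//= deriveE// -jacobianE /=.
by rewrite chart_invK.
Qed.

Lemma immersion_row_free m (f : M -> 'rV[R]_m) c x : immersion f -> atlas c ->
  chart_dom c x -> row_free (jacobian (in_chart f c) (c x)).
Proof. by move=> imf /imf[_ +] cx => /(_ _ cx) /injective_row_free. Qed.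

Lemma immersion_smooth m (f : M -> 'rV[R]_m) c : immersion f -> atlas c ->
  smooth_on (chart_img c) (in_chart f c).
Proof. by move=> imf /imf[]. Qed.

Definition chart_defect m (Om : 'M[R]_m) (f : M -> 'rV[R]_m) c x : R :=
  defect Om (jacobian (in_chart f c) (c x)).

Lemma chart_defect_indep m (Om : 'M[R]_m) (f : M -> 'rV[R]_m) c d x : immersion f ->
    atlas c -> atlas d -> chart_dom c x -> chart_dom d x ->
  chart_defect Om f c x = chart_defect Om f d x.
Proof.
move=> imf ac ad cx dx; rewrite /chart_defect.
have dfc := smooth_on_differentiable (immersion_smooth imf ac) (chart_img_map cx).
have dfd := smooth_on_differentiable (immersion_smooth imf ad) (chart_img_map dx).
have [B JB] := jacobian_chart_change ac ad cx dx dfc dfd.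
have fc := gram_unit (immersion_row_free imf ac cx).
have fd := gram_unit (immersion_row_free imf ad dx).
suff Bu : B \in unitmx by rewrite JB /defect projector_mul.
move: fc; rewrite JB trmx_mul !mulmxA -(mulmxA B) !unitmx_mul.
by case/andP => /andP[].
Qed.

End Charts.

Lemma lagrangianP (R : realType) n (M : smooth_manifold R n) (f : M -> 'rV[R]_(n + n)) :
  immersion f -> lagrangian f <->
  (forall c x, atlas c -> chart_dom c x -> chart_defect (symplectic_mx n) f c x = 0).
Proof.
move=> imf; split=> [lf c x ac cx|df c x ac cx a b].
  apply/eqP; rewrite /chart_defect defect_eq0; last first.
    exact: gram_unit (immersion_row_free imf ac cx).
  apply/eqP/matrixP => i j; have := lf c x ac cx (delta_mx 0 i) (delta_mx 0 j).
  rewrite symplectic_formE !jacobianE trmx_mul trmx_delta !mulmxA.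
  by rewrite -!(mulmxA (delta_mx 0 i)) -rowE -colE !mxE.
have /eqP := df c x ac cx; rewrite /chart_defect defect_eq0; last first.
  exact: gram_unit (immersion_row_free imf ac cx).
move=> /eqP J0; rewrite symplectic_formE !jacobianE.
move: J0; set J := jacobian _ _ => J0.
have -> : a *m J *m symplectic_mx n *m (b *m J)^T =
    a *m (J *m symplectic_mx n *m J^T) *m b^T by rewrite trmx_mul !mulmxA.
by rewrite J0 mulmx0 mul0mx mxE.
Qed.

(** * Smooth local extensions of the flow *)

(** The difference quotients agree, because the time does not move. *)
Lemma slice_derive (R : realType) (V W : normedModType R) (G : (V * R)%type -> W) v (t : R) :
  (fun q => 'D_((v, 0) : (V * R)%type) G (q, t)) = 'D_v (fun q => G (q, t)).
Proof.
apply/funext => q; rewrite /derive; apply: (congr1 (fun g : R -> W => lim (g @ (0 : R)^'))).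
apply/funext => h /=; congr (_ *: (G _ - _)).
rewrite [LHS]surjective_pairing /=.
by congr (_, _); rewrite scaler0 add0r.
Qed.

Lemma cvg_to_pair {S : Type} {Y Z : topologicalType} (F : set_system S) {FF : Filter F}
    (f : S -> Y) (g : S -> Z) (y : Y) (z : Z) :
  f x @[x --> F] --> y -> g x @[x --> F] --> z -> (f x, g x) @[x --> F] --> (y, z).
Proof. by move=> fy gz; exact: cvg_pair fy gz. Qed.

Section TimeInterval.
Context {R : realType}.
Variables (T t : R) (T_gt0 : 0 < T) (t0T : 0 <= t <= T).

(** This also covers the times 0 and T; it makes one-sided derivatives unique. *)
Lemma within_time_proper : ProperFilter (within `[0, T]%classic (t^')).
Proof.
apply: Build_ProperFilter_ex => P /nbhs_ballP[e /= e0 He].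
have [t0 tT] := andP t0T.
have [tltT|Tlet] := ltP t T.
  have m0 : 0 < Num.min e (T - t) by rewrite lt_min e0 subr_gt0.
  have : Num.min e (T - t) / 2 < Num.min e (T - t).
    by rewrite ltr_pdivrMr// ltr_pMr// ltr1n.
  set d := Num.min e (T - t) / 2; have d0 : 0 < d by rewrite divr_gt0.
  rewrite lt_min => /andP[de dT]; exists (t + d); apply: He.
  - by rewrite /ball /= opprD addrA subrr sub0r normrN gtr0_norm.
  - by rewrite -subr_eq0 addrAC subrr add0r gt_eqF.
  - by rewrite /= in_itv /=; apply/andP; split; lra.
have m0 : 0 < Num.min e T by rewrite lt_min e0.
have : Num.min e T / 2 < Num.min e T by rewrite ltr_pdivrMr// ltr_pMr// ltr1n.
set d := Num.min e T / 2; have d0 : 0 < d by rewrite divr_gt0.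
rewrite lt_min => /andP[de dT]; exists (t - d); apply: He.
- by rewrite /ball /= opprB addrC subrK gtr0_norm.
- by rewrite -subr_eq0 addrAC subrr add0r oppr_eq0 gt_eqF.
- by rewrite /= in_itv /=; apply/andP; split; lra.
Qed.

Lemma cvg_time_shift : s - t @[s --> within `[0, T]%classic (t^')] --> (0 : R)^'.
Proof.
move=> P /nbhs_ballP[e /= e0 He]; apply/nbhs_ballP; exists e => // s ts st _.
by apply: He; [rewrite /ball /= sub0r opprB|rewrite subr_eq0].
Qed.

Lemma within_time_near (P : R -> Prop) : (\forall s \near t, P s) ->
  \forall s \near within `[0, T]%classic (t^'), P s /\ 0 <= s <= T.
Proof.
move=> /nbhs_ballP[e /= e0 He]; apply/nbhs_ballP; exists e => // s ts st.
by rewrite /= in_itv /=; split => //; exact: He.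
Qed.

End TimeInterval.

Section Extension.
Context {R : realType} {n : nat} {M : smooth_manifold R n}.
Local Notation m := (n + n)%N.
Variables (T : R) (F : M -> R -> 'rV[R]_m).
Hypothesis T_gt0 : 0 < T.
Hypothesis F_immersion : forall t, 0 <= t <= T -> immersion (F ^~ t).
Variables (c : chart R n M) (ac : atlas c).
Variables (W : set ('rV[R]_n * R)%type) (G : ('rV[R]_n * R)%type -> 'rV[R]_m).
Hypotheses (oW : open W) (sG : smooth_on W G).
Hypothesis GF : forall q s, W (q, s) -> chart_img c q -> 0 <= s <= T ->
  G (q, s) = F (chart_inv c q) s.
Local Notation f s := (in_chart (F ^~ s) c).

Lemma near_slice q s : W (q, s) -> \forall y \near q, W (y, s).
Proof.
move=> Wqs; have yq : (fun y : 'rV[R]_n => (y, s)) y @[y --> q] --> (q, s).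
  exact: (cvg_to_pair (@cvg_id _ _) (@cvg_cst _ _ _ _ _)).
exact: (yq _ (open_nbhs_nbhs (conj oW Wqs))).
Qed.

Lemma near_slice_eq q s : W (q, s) -> chart_img c q -> 0 <= s <= T ->
  \forall y \near q, [/\ W (y, s), chart_img c y & G (y, s) = f s y].
Proof.
move=> Wqs cq s0T.
by apply: filterS2 (near_slice Wqs) (near_chart_img cq) => y Wy cy; split => //; exact: GF.
Qed.

Lemma ext_derive q s v : W (q, s) -> chart_img c q -> 0 <= s <= T ->
  'D_((v, 0) : ('rV[R]_n * R)%type) G (q, s) = 'D_v (f s) q.
Proof.
move=> Wqs cq s0T; have /(congr1 (fun h => h q)) /= -> := slice_derive G v s.
apply: near_eq_derive; apply: filterS (near_slice_eq Wqs cq s0T) => y [] //.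
Qed.

Lemma ext_derive2 q s u v : W (q, s) -> chart_img c q -> 0 <= s <= T ->
  'D_((u, 0) : ('rV[R]_n * R)%type) ('D_((v, 0) : ('rV[R]_n * R)%type) G) (q, s)
  = 'D_u ('D_v (f s)) q.
Proof.
move=> Wqs cq s0T.
apply: (etrans (congr1 (fun h => h q) (slice_derive ('D_((v, 0) : ('rV[R]_n * R)%type) G) u s))).
apply: near_eq_derive; apply: filterS (near_slice_eq Wqs cq s0T) => y [Wy cy _].
exact: ext_derive.
Qed.

Section Frame.
Variables (A : 'M[R]_n).
Definition frame_directions (a : 'I_n) : ('rV[R]_n * R)%type := (row a A, 0).
Local Notation e := frame_directions.

Lemma ext_frame_jacobian q s : W (q, s) -> chart_img c q -> 0 <= s <= T ->
  frame_jacobian G e (q, s) = frame_rows (f s) q A.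
Proof.
move=> Wqs cq s0T; apply/row_matrixP => a; rewrite !row_rows_mx.
exact: ext_derive.
Qed.

Lemma ext_frame_jacobianE q s : W (q, s) -> chart_img c q -> 0 <= s <= T ->
  frame_jacobian G e (q, s) = A *m jacobian (f s) q.
Proof.
move=> Wqs cq s0T; rewrite ext_frame_jacobian//.
by rewrite (frame_rowsE (immersion_smooth (F_immersion s0T) ac)).
Qed.

Lemma ext_row_free q s : chart_img c q -> 0 <= s <= T -> row_free (jacobian (f s) q).
Proof.
move=> [y cy <-] s0T; exact: immersion_row_free (F_immersion s0T) ac cy.
Qed.

Lemma ext_defect (Om : 'M[R]_m) q s : W (q, s) -> chart_img c q -> 0 <= s <= T ->
    A \in unitmx ->
  frame_jacobian G e (q, s) *m (frame_jacobian G e (q, s))^T \in unitmx /\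
  defect Om (frame_jacobian G e (q, s)) = chart_defect Om (F ^~ s) c (chart_inv c q).
Proof.
move=> Wqs cq s0T Au; have Ju := gram_unit (ext_row_free cq s0T).
rewrite ext_frame_jacobianE//; split.
  by rewrite trmx_mul !mulmxA -(mulmxA A) !unitmx_mul Au unitmx_tr Au andbT.
by rewrite /chart_defect chart_map_inv// /defect projector_mul.
Qed.

Lemma ext_mean_curvature q s : W (q, s) -> chart_img c q -> 0 <= s <= T ->
    A \in unitmx ->
  frame_mean_curvature G e (q, s) = mean_curvature (f s) q.
Proof.
move=> Wqs cq s0T Au.
rewrite (mean_curvature_frame (@open_chart_img _ _ _ c)
  (immersion_smooth (F_immersion s0T) ac) cq Au (ext_row_free cq s0T)).
rewrite /frame_mean_curvature (ext_frame_jacobian Wqs cq s0T).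
apply: eq_bigr => a _; apply: eq_bigr => b _.
apply: (congr1 (fun v => _ *: (v *m _))); exact: ext_derive2.
Qed.

End Frame.

Hypothesis flow : forall x t, chart_dom c x -> 0 <= t <= T ->
  (s - t)^-1 *: (F x s - F x t) @[s --> within `[0, T] t^'] -->
    mean_curvature (f t) (c x).

Lemma near_time q t : W (q, t) -> \forall s \near t, W (q, s).
Proof.
move=> Wqs; have yq : (fun s : R => (q, s)) s @[s --> t] --> (q, t).
  exact: (cvg_to_pair (@cvg_cst _ _ _ _ _) (@cvg_id _ _)).
exact: (yq _ (open_nbhs_nbhs (conj oW Wqs))).
Qed.

(** The derivative of the extension is two-sided; over the times from 0
    to T its difference quotient is the one of the flow, end points included. *)
Lemma ext_time_derivative q t : W (q, t) -> chart_img c q -> 0 <= t <= T ->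
  'D_((0, 1) : ('rV[R]_n * R)%type) G (q, t) = mean_curvature (f t) q.
Proof.
move=> Wqt cq t0T; have PF := within_time_proper T_gt0 t0T.
have /is_deriveP dG := smooth_is_derive ((0, 1) : ('rV[R]_n * R)%type) sG Wqt.
have cG := cvg_comp _ _ (@cvg_time_shift R T t) dG.
have cF := flow (chart_img_inv cq) t0T; rewrite chart_map_inv// in cF.
suff cF' : (s - t)^-1 *: (F (chart_inv c q) s - F (chart_inv c q) t)
    @[s --> within `[0, T]%classic (t^')] --> 'D_((0, 1) : ('rV[R]_n * R)%type) G (q, t).
  exact: (cvg_unique (@norm_hausdorff R _) cF' cF).
apply: cvg_trans cG; apply: near_eq_cvg.
have nW := within_time_near T (near_time Wqt).
apply: filterS nW => s [Ws s0T] /=.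
have -> : (s - t) *: ((0, 1) : ('rV[R]_n * R)%type) + (q, t) = (q, s).
  rewrite [LHS]surjective_pairing /=; congr (_, _); first by rewrite scaler0 add0r.
  by rewrite [_%:A]mulr1 subrK.
by rewrite !GF.
Qed.

End Extension.

(** * The barrier function on the manifold *)

Section MeanCurvatureFlow.
Context {R : realType} {n : nat} {M : smooth_manifold R n}.
Local Notation m := (n + n)%N.
Variables (T : R) (F : M -> R -> 'rV[R]_m).
Hypothesis T_gt0 : 0 < T.
Hypothesis F_smooth : smooth_family T F.
Hypothesis F_immersion : forall t, 0 <= t <= T -> immersion (F ^~ t).
Hypothesis F_flow : forall (c : chart R n M) (x : M) (t : R),
  atlas c -> chart_dom c x -> 0 <= t <= T ->
  (s - t)^-1 *: (F x s - F x t) @[s --> within `[0, T] t^'] -->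
    mean_curvature (in_chart (F ^~ t) c) (c x).

Definition chart_at (x : M) : chart R n M := sval (cid2 (atlas_cover x)).

Lemma chart_at_atlas x : atlas (chart_at x).
Proof. exact: (s2valP (cid2 (atlas_cover x))). Qed.

Lemma chart_at_dom x : chart_dom (chart_at x) x.
Proof. exact: (s2valP' (cid2 (atlas_cover x))). Qed.

Definition tangent_defect (x : M) (t : R) : R :=
  chart_defect (symplectic_mx n) (F ^~ t) (chart_at x) x.
Local Notation u := tangent_defect.

Lemma tangent_defect_chart c x t : atlas c -> chart_dom c x -> 0 <= t <= T ->
  u x t = chart_defect (symplectic_mx n) (F ^~ t) c x.
Proof.
move=> ac cx t0T; apply: (chart_defect_indep _ (F_immersion t0T) (chart_at_atlas x) ac) => //.
exact: chart_at_dom.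
Qed.

Lemma tangent_defect_ge0 x t : 0 <= u x t.
Proof. exact: defect_ge0. Qed.

Lemma tangent_defect_le x t : 0 <= t <= T -> u x t <= n%:R.
Proof.
move=> t0T; apply: defect_le; first exact: symplectic_mx_orthogonal.
apply: gram_unit.
exact: immersion_row_free (F_immersion t0T) (chart_at_atlas x) (chart_at_dom x).
Qed.

Variables (C0 : R) (C0_gt0 : 0 < C0).
Hypothesis F_curvature : forall (c : chart R n M) (x : M) (t : R),
  atlas c -> chart_dom c x -> 0 <= t <= T ->
  sff_norm (in_chart (F ^~ t) c) (c x) <= C0.

Section Displacement.
Variables (x : M) (k : 'I_m).
Local Notation c := (chart_at x).

Let ext s : 0 <= s <= T -> exists W G,
  [/\ open W, W (c x, s), smooth_on W G &
    forall q s', W (q, s') -> chart_img c q -> 0 <= s' <= T ->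
     G (q, s') = F (chart_inv c q) s'].
Proof.
exact: (F_smooth (chart_at_atlas x) (chart_img_map (chart_at_dom x))).
Qed.

Let near_ext (W : set ('rV[R]_n * R)%type) (G : ('rV[R]_n * R)%type -> 'rV[R]_m) s :
  open W -> W (c x, s) ->
  (forall q s', W (q, s') -> chart_img c q -> 0 <= s' <= T ->
     G (q, s') = F (chart_inv c q) s') ->
  \forall s' \near s, 0 <= s' <= T -> G (c x, s') 0 k = F x s' 0 k.
Proof.
move=> oW Ws GF; apply: filterS (near_time oW Ws) => s' Ws' s'0T.
by rewrite GF// ?chart_invK//; [exact: chart_at_dom|exact/chart_img_map/chart_at_dom].
Qed.

Let line_G (G : ('rV[R]_n * R)%type -> 'rV[R]_m) W s : smooth_on W G -> W (c x, s) ->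
  is_derive s 1 (fun s' => G (c x, s') 0 k)
    ('D_((0, 1) : ('rV[R]_n * R)%type) G (c x, s) 0 k).
Proof.
move=> sG Ws.
have pE (s' : R) : ((c x, 0) : ('rV[R]_n * R)%type) + s' *: (0, 1) = (c x, s').
  rewrite [LHS]surjective_pairing /=; congr (_, _); first by rewrite scaler0 addr0.
  by rewrite add0r [_%:A]mulr1.
have := smooth_derive_row ((0, 1) : ('rV[R]_n * R)%type) k sG Ws.
rewrite -{1}pE => /is_derive_line; apply: is_derive_ext => s'.
by rewrite pE.
Qed.

(** The speed of each coordinate is a coordinate of H, which is at most
    n C0 in absolute value by [mean_curvature_bound]. *)
Lemma displacement_le t : 0 <= t <= T -> `|F x t 0 k - F x 0 0 k| <= n%:R * C0 * T.
Proof.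
move=> /andP[t0 tT].
have nC0 : 0 <= n%:R * C0 by rewrite mulr_ge0// ltW.
pose h s := mean_curvature (in_chart (F ^~ s) c) (c x) 0 k.
have in0T s : s \in `]0, t[ -> 0 <= s <= T.
  rewrite in_itv /= => /andP[s0 st]; rewrite (ltW s0) /=.
  exact: ltW (lt_le_trans st tT).
have dphi s : s \in `]0, t[ -> is_derive s 1 (fun s => F x s 0 k) (h s).
  move=> s0t; have s0T := in0T s s0t.
  have [W [G [oW Ws sG GF]]] := ext s0T.
  rewrite /h -(ext_time_derivative T_gt0 oW sG GF (fun x t => F_flow (chart_at_atlas _))
    Ws (chart_img_map (chart_at_dom x)) s0T).
  apply: near_eq_is_derive (line_G sG Ws).
  have nin : \forall s' \near s, 0 <= s' <= T.
    move: s0t; rewrite in_itv /= => /andP[s0 st].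
    have n1 := lt_nbhsr s0; have n2 := lt_nbhsl (lt_le_trans st tT).
    by apply: filterS2 n1 n2 => s' /ltW -> /ltW ->.
  by apply: filterS2 nin (near_ext oW Ws GF) => s' ? /(_ _) ->.
have cphi : {within `[0, t], continuous (fun s => F x s 0 k)}.
  apply/subspace_continuousP => s /=; rewrite in_itv /= => /andP[s0 st].
  have s0T : 0 <= s <= T by rewrite s0 (le_trans st).
  have [W [G [oW Ws sG GF]]] := ext s0T.
  have cG : (fun s' => G (c x, s') 0 k) @ s --> G (c x, s) 0 k.
    apply: (@differentiable_continuous _ _ _ s (fun s' => G (c x, s') 0 k)).
    by apply/derivable1_diffP; case: (line_G sG Ws).
  have eqs : G (c x, s) 0 k = F x s 0 k by exact: (nbhs_singleton (near_ext oW Ws GF)).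
  suff : F x s' 0 k @[s' --> within `[0, t]%classic (nbhs s)] --> F x s 0 k by [].
  rewrite -eqs; apply: cvg_trans (cvg_within_filter _ cG).
  apply: near_eq_cvg; rewrite near_withinE.
  apply: filterS (near_ext oW Ws GF) => s' s'E /=; rewrite in_itv /= => /andP[s'0 s't].
  by rewrite s'E// s'0 (le_trans s't).
have [d /[!in_itv]/= dt ->] := MVT_segment t0 dphi cphi.
rewrite subr0 normrM (ger0_norm t0); apply: ler_pM => //.
have d0T : 0 <= d <= T by have /andP[-> dt'] := dt; rewrite (le_trans dt').
apply: (mean_curvature_bound (@open_chart_img _ _ _ c)
  (immersion_smooth (F_immersion d0T) (chart_at_atlas x)) (chart_img_map (chart_at_dom x))).
  exact: immersion_row_free (F_immersion d0T) (chart_at_atlas x) (chart_at_dom x).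
exact: F_curvature (chart_at_atlas x) (chart_at_dom x) d0T.
Qed.

End Displacement.

Variables (eps : R) (eps_gt0 : 0 < eps).

(** The exponential absorbs the reaction term 8 |A|^2 u; subtracting
    eps |F|^2 confines the positive values to a compact set, and the extra eps t
    makes the differential inequality strict. *)
Definition barrier (x : M) (t : R) : R :=
  expR (- (8 * C0 ^+ 2) * t) * u x t
  - eps * (frob (F x t) (F x t) + (2 * n%:R + 1) * t).
Local Notation w := barrier.

(** In a chart the barrier is built from the first derivatives of a smooth local
    extension; independence of the chart makes this valid near the point. *)
Lemma barrier_continuous (K : set M) :
  {within K `*` `[0, T]%classic, continuous (fun z : M * R => w z.1 z.2)}.
Proof.
apply/subspace_continuousP => -[x t] [/= Kx]; rewrite in_itv /= => t0T.
pose c := chart_at x.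
have ac := chart_at_atlas x; have cx := chart_at_dom x; rewrite -/c in ac cx.
have [W [G [oW Wxt sG GF]]] := F_smooth ac (chart_img_map cx) t0T.
pose e := @frame_directions R n 1%:M.
pose h (z : 'rV[R]_n * R) := expR (- (8 * C0 ^+ 2) * z.2) *
   defect (symplectic_mx n) (frame_jacobian G e z)
  - eps * (frob (G z) (G z) + (2 * n%:R + 1) * z.2).
pose cc (z : M * R) : 'rV[R]_n * R := (c z.1, z.2).
have ccE : cc z @[z --> (x, t)] --> (c x, t).
  apply: cvg_to_pair; last exact: cvg_snd.
  exact: (cvg_comp _ _ (@cvg_fst _ _ _ _ _) (chart_map_cvg cx)).
have ch : h z @[z --> (c x, t)] --> h (c x, t).
  have sndc : z.2 @[z --> ((c x, t) : 'rV[R]_n * R)] --> t by exact: cvg_snd.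
  have exp_cvg : expR (- (8 * C0 ^+ 2) * z.2) @[z --> ((c x, t) : 'rV[R]_n * R)]
      --> expR (- (8 * C0 ^+ 2) * t).
    have lin : - (8 * C0 ^+ 2) * z.2 @[z --> ((c x, t) : 'rV[R]_n * R)]
      --> - (8 * C0 ^+ 2) * t by exact: cvgMl_tmp.
    exact: (cvg_comp _ _ lin (@continuous_expR R _)).
  have defect_cvg : defect (symplectic_mx n) (frame_jacobian G e z) @[z --> (c x, t)]
      --> defect (symplectic_mx n) (frame_jacobian G e (c x, t)).
    apply: cvg_defect.
      have [+ _] := ext_defect F_immersion ac oW GF (symplectic_mx n) Wxt
        (chart_img_map cx) t0T (unitmx1 _ _).
      exact.
    move=> a k; rewrite mxE; under eq_fun do rewrite mxE.
    exact: (smooth_row_continuous (smooth_on_derive (e a) sG) Wxt).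
  have norm_cvg : frob (G z) (G z) @[z --> (c x, t)] --> frob (G (c x, t)) (G (c x, t)).
    have cG : mx_cvg (nbhs (c x, t)) G (G (c x, t)).
      by move=> a k; rewrite ord1; exact: (smooth_row_continuous sG Wxt).
    exact: cvg_frob.
  have time_cvg : (2 * n%:R + 1) * z.2 @[z --> ((c x, t) : 'rV[R]_n * R)]
      --> (2 * n%:R + 1) * t by exact: cvgMl_tmp.
  have a1 := cvgM exp_cvg defect_cvg.
  have a2 := cvgD norm_cvg time_cvg.
  have a3 : eps * (frob (G z) (G z) + (2 * n%:R + 1) * z.2)
      @[z --> ((c x, t) : 'rV[R]_n * R)]
      --> eps * (frob (G (c x, t)) (G (c x, t)) + (2 * n%:R + 1) * t).
    by apply: cvgMl_tmp; exact: (a2 _).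
  exact: (cvgB (a1 _) a3).
have hE : \forall z \near (x, t), 0 <= z.2 <= T -> h (cc z) = w z.1 z.2.
  have nW : \forall z \near (x, t), W (cc z) by exact: (ccE _ (open_nbhs_nbhs (conj oW Wxt))).
  have nd : \forall z \near (x, t), chart_dom c z.1.
    exact: (@cvg_fst _ _ _ (nbhs t) _ _ (near_chart_dom cx)).
  apply: filterS2 nW nd => -[y s] /= Wys cy s0T; rewrite /h /w /=.
  have [_ ->] := ext_defect F_immersion ac oW GF (symplectic_mx n) Wys
        (chart_img_map cy) s0T (unitmx1 _ _).
  rewrite (tangent_defect_chart ac cy s0T) (GF _ _ Wys (chart_img_map cy) s0T).
  by rewrite (chart_invK cy).
have hxt : h (c x, t) = w x t by exact: (nbhs_singleton hE).
suff : w z.1 z.2 @[z --> within (K `*` `[0, T]%classic) (nbhs (x, t))] --> w x t by [].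
rewrite -hxt; apply: cvg_trans (cvg_within_filter _ (cvg_comp _ _ ccE ch)).
apply: near_eq_cvg; rewrite near_withinE.
by apply: filterS hE => -[y s] /= hys [_]; rewrite /= in_itv /= => /hys.
Qed.

Hypothesis F0_lagrangian : lagrangian (F ^~ 0).
Hypothesis F0_proper : proper_map (F ^~ 0).

Lemma barrier_initial x : w x 0 <= 0.
Proof.
have t00 : 0 <= (0 : R) <= T by rewrite lexx ltW.
have u0 : u x 0 = 0.
  have /(lagrangianP (F_immersion t00)) := F0_lagrangian; apply.
  - exact: chart_at_atlas.
  - exact: chart_at_dom.
rewrite /w u0 mulr0 sub0r oppr_le0 mulr0 addr0 mulr_ge0 ?frob_ge0//.
exact: ltW.
Qed.

Let shift_space (h d f k d0 f0 : R) :
  h * d - eps * (f + k) <= h * d0 - eps * (f0 + k) -> h * d - eps * f <= h * d0 - eps * f0.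
Proof. lra. Qed.

Let shift_time (h h' d f k t s d0 f0 : R) :
  h * h' * d - eps * (f + k * (t + s)) <= h * d0 - eps * (f0 + k * t) ->
  h' * (h * d) - eps * (f + k * s) <= h * d0 - eps * f0.
Proof. by rewrite mulrA (mulrC h'); lra. Qed.

(** In a chart, and for a frame [A] which is orthonormal at the point, all the
    hypotheses of [no_interior_maximum] hold; only times before [t0] are
    compared, so [t0 = T] is allowed. *)
Lemma barrier_no_positive_maximum x0 t0 : 0 < t0 <= T ->
  (forall x t, 0 <= t <= T -> w x t <= w x0 t0) -> False.
Proof.
move=> /andP[t0p t0leT] wmax.
have t0T : 0 <= t0 <= T by rewrite (ltW t0p).
pose c := chart_at x0.
have ac := chart_at_atlas x0; have cx := chart_at_dom x0; rewrite -/c in ac cx.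
have cp := chart_img_map cx; set p := c x0 in cp *.
have [W [G [oW Wz sG GF]]] := F_smooth ac cp t0T; rewrite -/p in Wz.
pose f := in_chart (F ^~ t0) c.
have sf : smooth_on (chart_img c) f := immersion_smooth (F_immersion t0T) ac.
have Jf : row_free (jacobian f p) := immersion_row_free (F_immersion t0T) ac cx.
have [A Au AJ] := orthonormal_frame Jf.
pose e := frame_directions A.
pose tau : ('rV[R]_n * R)%type := (0, 1).
have JE : frame_jacobian G e (p, t0) = A *m jacobian f p.
  exact: (ext_frame_jacobianE F_immersion ac oW GF).
have lineE a (s : R) : ((p, t0) : ('rV[R]_n * R)%type) + s *: e a = (p + s *: row a A, t0).
  rewrite [LHS]surjective_pairing /=; congr (_, _).
  by rewrite scaler0 addr0.
have tauE (s : R) : ((p, t0) : ('rV[R]_n * R)%type) + s *: tau = (p, t0 + s).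
  rewrite [LHS]surjective_pairing /=; congr (_, _); first by rewrite scaler0 addr0.
  by rewrite [_%:A]mulr1.
have near_space a : \forall s \near (0 : R),
    W (p + s *: row a A, t0) /\ chart_img c (p + s *: row a A).
  apply: (@near_line _ _ (fun y => W (y, t0) /\ chart_img c y)).
  apply: filterS (near_slice_eq oW GF Wz cp t0T) => y [] //.
have near_tau : \forall s \near (0 : R), s <= 0 -> W (p, t0 + s) /\ 0 <= t0 + s <= T.
  have nW : \forall s \near (0 : R), W (p, t0 + s).
    have st0 : t0 + s @[s --> (0 : R)] --> t0.
      rewrite -[X in _ --> X]addr0; apply: cvgD; [exact: cvg_cst|exact: cvg_id].
    exact: (st0 _ (near_time oW Wz)).
  have nt : \forall s \near (0 : R), - t0 < s by apply: lt_nbhsr; rewrite oppr_lt0.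
  apply: filterS2 nW nt => s Ws ts s0; split=> //; apply/andP; split; lra.
have flow q t := ext_time_derivative T_gt0 oW sG GF (fun x t => F_flow ac) (q := q) (t := t).
have MC q t := ext_mean_curvature F_immersion ac oW GF (A := A) (q := q) (s := t).
pose h0 := expR (- (8 * C0 ^+ 2) * t0).
have h0p : 0 < h0 by exact: expR_gt0.
have DE := ext_defect F_immersion ac oW GF (symplectic_mx n) (A := A).
have GE q s : W (q, s) -> chart_img c q -> 0 <= s <= T -> G (q, s) = F (chart_inv c q) s := GF q s.
have wE : w x0 t0 = h0 * defect (symplectic_mx n) (frame_jacobian G e (p, t0))
    - eps * (frob (G (p, t0)) (G (p, t0)) + (2 * n%:R + 1) * t0).
  have [_ ->] := DE p t0 Wz cp t0T Au.
  by rewrite (GE _ _ Wz cp t0T) /p (chart_invK cx) /w (tangent_defect_chart ac cx t0T).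
apply: (@no_interior_maximum R ('rV[R]_n * R)%type n W oW G sG (p, t0) Wz e tau _ _
  (symplectic_mx n) symplectic_mx_orthogonal symplectic_mx_skew
  (C0 ^+ 2) h0 eps h0p eps_gt0).
- move=> a; apply: filterS (near_space a) => s [Ws cs].
  by rewrite lineE MC// flow.
- by rewrite JE.
- by rewrite flow// MC.
- have fr : frame_rows f p A = A *m jacobian f p by exact: (frame_rowsE sf cp).
  have JJ : frame_rows f p A *m (frame_rows f p A)^T = 1%:M by rewrite fr.
  apply: le_trans (sff_frame (@open_chart_img _ _ _ c) sf cp Au Jf JJ
    (F_curvature ac cx t0T)).
  rewrite le_eqVlt; apply/orP; left; apply/eqP.
  rewrite JE (projector_mul (gram_unit Jf) Au).
  apply: eq_bigr => a _; apply: eq_bigr => b _.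
  apply: (congr1 (fun v => frob (v *m _) (v *m _))).
  exact: (ext_derive2 oW GF).
- move=> j; apply: filterS (near_space j) => s [Ws cs]; rewrite lineE.
  by have [] := DE _ _ Ws cs t0T Au.
- move=> j; apply: filterS (near_space j) => s [Ws cs]; rewrite lineE.
  have := wmax (chart_inv c (p + s *: row j A)) t0 t0T.
  rewrite wE /w -/h0 (tangent_defect_chart ac (chart_img_inv cs) t0T).
  have [_ <-] := DE _ _ Ws cs t0T Au.
  rewrite -(GE _ _ Ws cs t0T); exact: shift_space.
- apply: filterS near_tau => s nt s0; have [Ws ts] := nt s0; rewrite tauE.
  by have [] := DE _ _ Ws cp ts Au.
- apply: filterS near_tau => s nt s0; have [Ws ts] := nt s0; rewrite tauE.
  have := wmax x0 (t0 + s) ts.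
  rewrite wE /w (tangent_defect_chart ac cx ts) -{1 2 3}(chart_invK cx).
  have [_ <-] := DE _ _ Ws cp ts Au.
  rewrite -(GE _ _ Ws cp ts) mulrDr expRD -/h0; exact: shift_time.
Qed.

Lemma barrier_bound x t : 0 <= t <= T -> w x t <= n%:R - eps * frob (F x t) (F x t).
Proof.
move=> t0T; have [t0 tT] := andP t0T; rewrite /barrier mulrDr opprD addrA.
apply: le_trans (_ : expR (- (8 * C0 ^+ 2) * t) * u x t -
  eps * frob (F x t) (F x t) <= _).
  by rewrite gerDl oppr_le0 !mulr_ge0 ?addr_ge0 ?mulr_ge0// ltW.
rewrite lerD2r; apply: le_trans (tangent_defect_le x t0T).
rewrite -[leRHS]mul1r; apply: ler_wpM2r; first exact: tangent_defect_ge0.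
by rewrite -expR0 ler_expR mulNr oppr_le0 mulr_ge0// mulr_ge0// sqr_ge0.
Qed.

(** Where the barrier is positive, |F|^2 < n / eps, and the initial position is at
    bounded distance. *)
Lemma barrier_positive_compact x t : 0 <= t <= T -> 0 < w x t ->
  forall k, `|F x 0 0 k| <= 1 + n%:R / eps + n%:R * C0 * T.
Proof.
move=> t0T wp k.
have fn : frob (F x t) (F x t) <= n%:R / eps.
  rewrite ler_pdivlMr// mulrC; have := barrier_bound x t0T; lra.
have e1 := le_trans (frob_entry_le (F x t) 0 k) fn.
have b0 : 0 <= n%:R / eps by rewrite divr_ge0// ltW.
have Ft : `|F x t 0 k| <= 1 + n%:R / eps.
  rewrite -ler_sqr ?nnegrE ?addr_ge0// real_normK ?num_real//.
  apply: le_trans e1 _; move: b0; set b := n%:R / eps; nra.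
have := displacement_le x k t0T.
rewrite distrC => dk.
have -> : F x 0 0 k = F x t 0 k + (F x 0 0 k - F x t 0 k) by rewrite addrC subrK.
by apply: le_trans (ler_normD _ _) _; rewrite lerD.
Qed.

Lemma barrier_le0 x t : 0 <= t <= T -> w x t <= 0.
Proof.
move=> t0T; rewrite leNgt; apply/negP => wp.
pose rho := 1 + n%:R / eps + n%:R * C0 * T.
pose cube := [set v : 'rV[R]_m | forall i, `[- rho, rho]%classic (v ord0 i)].
have cube_compact : compact cube.
  by apply: (@rV_compact _ _ (fun=> `[- rho, rho]%classic)) => _; exact: segment_compact.
pose K := (F ^~ 0) @^-1` cube.
have K_compact : compact K by exact: F0_proper.
have inK y s : 0 <= s <= T -> 0 < w y s -> K y.
  move=> s0T wys i; rewrite /= in_itv /= -ler_norml.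
  exact: (barrier_positive_compact s0T wys).
have KT_compact := compact_setX K_compact (@segment_compact R 0 T).
have inKT y s : 0 <= s <= T -> 0 < w y s -> (K `*` `[0, T]%classic) (y, s).
  by move=> s0T wys; split; [exact: inK wys|rewrite /= in_itv].
have KT0 : K `*` `[0, T]%classic !=set0 by exists (x, t); exact: inKT.
have [[x0 t0]] := compact_EVT_max KT0 KT_compact (@barrier_continuous K).
rewrite inE => -[/= Kx0]; rewrite in_itv /= => t00T wmax.
have w0p : 0 < w x0 t0.
  exact: (lt_le_trans wp (wmax (x, t) (mem_set (inKT x t t0T wp)))).
have [t0p t0leT] := andP t00T.
have t0_gt0 : 0 < t0.
  rewrite lt_neqAle t0p andbT; apply/eqP => t0E; move: w0p; rewrite -t0E ltNge.
  by rewrite barrier_initial.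
apply: (@barrier_no_positive_maximum x0 t0); first by rewrite t0_gt0.
move=> y s s0T; have [wys|wys] := leP (w y s) 0; first exact: le_trans wys (ltW w0p).
by apply: (wmax (y, s)); exact: (mem_set (inKT y s s0T wys)).
Qed.

End MeanCurvatureFlow.

Theorem corollary1p1 (R : realType) (n : nat) (M : smooth_manifold R n)
    (F0 : M -> 'rV[R]_(n + n)) (T : R) (F : M -> R -> 'rV[R]_(n + n))
    (T_gt0 : 0 < T)
    (F0_immersion : immersion F0)
    (F0_lagrangian : lagrangian F0)
    (F0_proper : proper_map F0)
    (F_flow : mean_curvature_flow T F)
    (F_initial : forall x : M, F x 0 = F0 x)
    (F_bounded : bounded_second_fundamental_form T F) :
  forall t : R, 0 <= t <= T -> lagrangian (F ^~ t).
Proof.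
move=> t t0T; have [F_smooth F_imm F_evol] := F_flow.
have [C0 C0_gt0 F_curv] := F_bounded.
have F00 : F ^~ 0 = F0 by apply/funext => x; rewrite F_initial.
apply/(lagrangianP (F_imm t t0T)) => c x ac cx.
rewrite -(tangent_defect_chart F_imm ac cx t0T).
apply/eqP; rewrite eq_le tangent_defect_ge0 andbT.
pose a := frob (F x t) (F x t) + (2 * n%:R + 1) * t.
have [t0 tT] := andP t0T.
have a0 : 0 <= a by rewrite addr_ge0 ?frob_ge0// mulr_ge0// addr_ge0// mulr_ge0.
suff : expR (- (8 * C0 ^+ 2) * t) * tangent_defect F x t <= 0.
  by rewrite pmulr_rle0 ?expR_gt0.
apply/ler_addgt0Pl => d d0; rewrite addr0.
(* the weight of the barrier is chosen such that eps * a < d *)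
have e0 : 0 < d / (a + 1) by rewrite divr_gt0// ltr_wpDl.
have := @barrier_le0 R n M T F T_gt0 F_smooth F_imm F_evol C0 C0_gt0 F_curv _ e0.
rewrite F00 => /(_ F0_lagrangian F0_proper x t t0T).
rewrite /barrier -/a subr_le0 => /le_trans; apply.
by rewrite mulrAC ler_pdivrMr ?ltr_wpDl// ler_pM2l// lerDl.
Qed.
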